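(* Let $X=Lag(n,2n)\cong Sp(2n)/P_n$ $(n\ge2)$ be the Lagrangian Grassmannian, and let $\lambda_1,\dots,\lambda_n$ be the fundamental dominant weights of $Sp(2n)$. For every integer $r\ge0$ the irreducible decomposition of $\mathrm{Sym}^rT_X$ is $$\mathrm{Sym}^rT_X=\bigoplus_{\substack{i_1+2i_2+\dots+ni_n=r\\ i_1,\dots,i_n\ge0}}E_{i_1\cdot2\lambda_1+i_2\cdot2\lambda_2+\dots+i_n\cdot2\lambda_n}.$$ Hence the fundamental highest weights of $T_X^*$ are $2\lambda_1,\dots,2\lambda_n$, of degrees $1,\dots,n$ respectively.
   Context: Everything is over $\mathbb{C}$. $G=Sp(2n)$ is of type $C_n$, simple roots $\alpha_i$ and fundamental weights $\lambda_i$ in Bourbaki order; $P_n$ is the maximal parabolic subgroup attached to $\alpha_n$, with the convention that its Lie algebra $\mathfrak p_n$ contains all negative root spaces, so that the weights of $\mathfrak g/\mathfrak p_n$ are the positive roots involving $\alpha_n$. Homogeneous vector bundles on $G/P_n$ are identified with $P_n$-modules, $T_X$ corresponding to $\mathfrak g/\mathfrak p_n$. $E_\lambda$ denotes the irreducible homogeneous vector bundle (irreducible $P_n$-module) with highest weight $\lambda$ with respect to the Levi part $R$ of $P_n$. Fundamental highest weights: for an $R$-module $V$ such that every irreducible $R$-module occurs at most once in the algebra of polynomials $\mathcal P(V)=\bigoplus_{i\ge0}\mathrm{Sym}^i(V^* )$, let $\Lambda$ be the set of highest weights occurring in $\mathcal P(V)$ and $h_\lambda$ the (unique up to scalar, homogeneous)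 highest weight vector of weight $\lambda\in\Lambda$. The fundamental highest weights of $V$ are the $\lambda\in\Lambda$ with $h_\lambda$ an irreducible polynomial; the degree of a fundamental highest weight $\omega$ is $\deg h_\omega$. Those of $T_X^*$ are the ones for $V=(\mathfrak g/\mathfrak p_n)^*$, so $\mathcal P(V)=\bigoplus_r\mathrm{Sym}^r(\mathfrak g/\mathfrak p_n)$. *)

(* Defs.v *)
From HB Require Import structures.
From mathcomp Require Import all_boot all_order all_algebra.
From mathcomp Require Import mpoly complex.
From mathcomp Require Import reals.

Set Implicit Arguments.
Unset Strict Implicit.
Unset Printing Implicit Defensive.

Import GRing.Theory.
Local Open Scope ring_scope.

(** * Modules over a group of matrices

    A group is a predicate [G] on matrices, and [act] gives its action on the
    vector space [M]; submodules are Prop-valued predicates because [M] may be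
    infinite-dimensional. *)

Definition subspace (F : fieldType) (M : lmodType F) (W : M -> Prop) : Prop :=
  W 0 /\ forall (a : F) (u v : M), W u -> W v -> W (a *: u + v).

Definition submodule (F : fieldType) (m : nat) (M : lmodType F)
    (G : 'M[F]_m -> Prop) (act : 'M[F]_m -> M -> M) (W : M -> Prop) : Prop :=
  subspace W /\ forall g v, G g -> W v -> W (act g v).

Definition irreducible_submodule (F : fieldType) (m : nat) (M : lmodType F)
    (G : 'M[F]_m -> Prop) (act : 'M[F]_m -> M -> M) (W : M -> Prop) : Prop :=
  [/\ submodule G act W,
      exists2 v, W v & v != 0
    & forall S : M -> Prop, submodule G act S -> (forall v, S v -> W v) ->
        (forall v, S v -> v = 0) \/ (forall v, W v -> S v)].

Definition isomorphic_submodules (F : fieldType) (m : nat) (M : lmodType F)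
    (G : 'M[F]_m -> Prop) (act : 'M[F]_m -> M -> M) (W1 W2 : M -> Prop) : Prop :=
  exists phi : M -> M,
    [/\ forall (a : F) u v, W1 u -> W1 v -> phi (a *: u + v) = a *: phi u + phi v,
        forall u, W1 u -> W2 (phi u),
        forall u, W1 u -> phi u = 0 -> u = 0,
        forall w, W2 w -> exists2 u, W1 u & phi u = w
      & forall g u, G g -> W1 u -> phi (act g u) = act g (phi u)].

(* The subspace [S] is the internal direct sum of the [W i] with [P i]. *)
Definition is_direct_sum (F : fieldType) (M : lmodType F) (I : finType)
    (P : pred I) (W : I -> M -> Prop) (S : M -> Prop) : Prop :=
  (forall i, P i -> forall v, W i v -> S v) /\
  (forall v, S v -> exists! c : {ffun I -> M},
     [/\ forall i, P i -> W i (c i),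
         forall i, ~~ P i -> c i = 0
       & v = \sum_(i | P i) c i]).

(** * Quotients of subspaces

    [U / V] is realized on the complement [U :\: V] of [V] in [U]; [quot_pi] is
    the canonical projection, and [vsval] picks representatives in [U]. *)

Definition quot (F : fieldType) (L : vectType F) (U V : {vspace L}) : vectType F :=
  subvs_of (U :\: V)%VS.

Definition quot_pi (F : fieldType) (L : vectType F) (U V : {vspace L}) (x : L) :
    quot U V :=
  vsproj (U :\: V)%VS (addv_pi1 U V x).

Lemma quot_pi_eq0 (F : fieldType) (L : vectType F) (U V : {vspace L}) (x : L) :
  (V <= U)%VS -> x \in U -> (quot_pi U V x == 0) = (x \in V).
Proof.
move=> sVU xU; have memD : addv_pi1 U V x \in (U :\: V)%VS by exact: memv_pi.
have xUV : x \in (U + V)%VS by rewrite (subvP (addvSl U V)).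
have dec := addv_pi1_pi2 xUV; apply/eqP/idP => [pi0|xV].
  rewrite -dec -(vsprojK memD) -/(quot_pi U V x) pi0 linear0 add0r.
  exact: memv_pi2.
have -> : quot_pi U V x = vsproj (U :\: V)%VS 0; last exact: linear0.
by congr vsproj; move: dec; rewrite addv_pi2_id // -[RHS]add0r => /addIr.
Qed.

Lemma quot_piK (F : fieldType) (L : vectType F) (U V : {vspace L}) (w : quot U V) :
  quot_pi U V (vsval w) = w.
Proof.
rewrite /quot_pi daddv_pi_id ?vsvalK ?capv_diff //; exact: subvsP.
Qed.

(** * Symmetric algebras

    [Sym W] is the polynomial algebra on the basis [vbasis {:W}] of [W]; its
    part of degree [r] is [Sym^r W].  An endomorphism of [W] extends uniquely
    to an endomorphism of algebra. *)

Definition symAlg (F : fieldType) (W : vectType F) := {mpoly F[\dim {:W}]}.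

Definition sym_in (F : fieldType) (W : vectType F) (w : W) : symAlg W :=
  \sum_(i < \dim {:W}) coord (vbasis {:W}) i w *: 'X_i.

Definition sym_map (F : fieldType) (W : vectType F) (g : W -> W) (f : symAlg W) :
    symAlg W :=
  f \mPo [tuple sym_in (g (tnth (vbasis {:W}) i)) | i < \dim {:W}].

Definition Sym (F : fieldType) (W : vectType F) (r : nat) (f : symAlg W) : Prop :=
  f \is r.-homog.

Definition irreducible_mpoly (F : fieldType) (N : nat) (f : {mpoly F[N]}) : Prop :=
  [/\ f != 0, f \isn't a GRing.unit
    & forall p q : {mpoly F[N]}, f = p * q ->
        p \is a GRing.unit \/ q \is a GRing.unit].

(** * The symplectic group and its Lie algebra *)

Definition sympJ (F : fieldType) (n : nat) : 'M[F]_(n + n) :=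
  block_mx 0 1%:M (- 1%:M) 0.

Definition Sp (F : fieldType) (n : nat) (g : 'M[F]_(n + n)) : Prop :=
  g^T *m sympJ F n *m g = sympJ F n.

Definition sp_eqn (F : fieldType) (n : nat) (x : 'M[F]_(n + n)) : 'M[F]_(n + n) :=
  x^T *m sympJ F n + sympJ F n *m x.

Lemma sp_eqn_is_linear (F : fieldType) (n : nat) : linear (@sp_eqn F n).
Proof.
move=> a x y; rewrite /sp_eqn linearP /= mulmxDl mulmxDr -scalemxAl -scalemxAr.
by rewrite scalerDr addrACA.
Qed.

HB.instance Definition _ (F : fieldType) (n : nat) :=
  GRing.isLinear.Build F 'M[F]_(n + n) 'M[F]_(n + n) _ (@sp_eqn F n)
    (@sp_eqn_is_linear F n).

Definition sp (F : fieldType) (n : nat) : {vspace 'M[F]_(n + n)} :=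
  lker (linfun (@sp_eqn F n) : 'End('M[F]_(n + n))).

Lemma ursubmx_is_linear (F : fieldType) (m n p q : nat) :
  linear (@ursubmx F m n p q).
Proof. by move=> a x y; apply/matrixP=> i j; rewrite !mxE. Qed.

HB.instance Definition _ (F : fieldType) (m n p q : nat) :=
  GRing.isLinear.Build F 'M[F]_(m + n, p + q) 'M[F]_(m, q) _ (@ursubmx F m n p q)
    (@ursubmx_is_linear F m n p q).

(* The torus is [diag(t, t^-1)].  The [(i, j)] entry of the upper right block
   has weight [e_i + e_j], that of the upper left block [e_i - e_j], that of the
   lower left block [- e_i - e_j]: since [alpha_n = 2 e_n], the root spaces in
   the upper right block are those of the positive roots involving [alpha_n]. *)
Definition pn (F : fieldType) (n : nat) : {vspace 'M[F]_(n + n)} :=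
  (sp F n :&: lker (linfun (@ursubmx F n n n n) : 'Hom('M[F]_(n + n), 'M[F]_n)))%VS.

(* The stabilizer of the Lagrangian subspace of column vectors spanned by the
   last [n] vectors of the standard basis. *)
Definition Pn (F : fieldType) (n : nat) (g : 'M[F]_(n + n)) : Prop :=
  Sp g /\ ursubmx g = 0.

Definition Levi (F : fieldType) (n : nat) (g : 'M[F]_(n + n)) : Prop :=
  Pn g /\ dlsubmx g = 0.

Definition torus (F : fieldType) (n : nat) (t : 'rV[F]_n) : 'M[F]_(n + n) :=
  block_mx (diag_mx t) 0 0 (diag_mx (map_mx GRing.inv t)).

(* The unipotent radical of the positive Borel subgroup of the Levi part. *)
Definition Levi_unip (F : fieldType) (n : nat) (g : 'M[F]_(n + n)) : Prop :=
  Levi g /\ forall i j : 'I_n, (j <= i)%N -> ulsubmx g i j = (i == j)%:R.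

Lemma mem_sp (F : fieldType) (n : nat) (x : 'M[F]_(n + n)) :
  (x \in sp F n) = (x^T *m sympJ F n + sympJ F n *m x == 0).
Proof. by rewrite memv_ker lfunE. Qed.

Lemma mem_pn (F : fieldType) (n : nat) (x : 'M[F]_(n + n)) :
  (x \in pn F n) = (x \in sp F n) && (ursubmx x == 0).
Proof. by rewrite memv_cap memv_ker lfunE. Qed.

(** * Weights

    The weight lattice of [Sp(2n)] is [Z^n] with basis [e_1, ..., e_n]; all
    indices start at [0], so that [fund_weight k] is [lambda_(k+1)]. *)

Definition weight (n : nat) := 'rV[int]_n.

Definition weight_char (F : fieldType) (n : nat) (mu : weight n) (t : 'rV[F]_n) : F :=
  \prod_(j < n) t 0 j ^ mu 0 j.

Definition fund_weight (n : nat) (k : 'I_n) : weight n :=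
  \row_j (j <= k)%N%:R.

(* The simple coroots [e_k - e_(k+1)], and [e_n] for the last one. *)
Definition simple_coroot (n : nat) (k : 'I_n) : weight n :=
  \row_j ((j == k)%:R - (j == k.+1 :> nat)%:R).

Lemma fund_weight_coroot (n : nat) (k l : 'I_n) :
  \sum_(j < n) fund_weight k 0 j * simple_coroot l 0 j = (k == l)%:R.
Proof.
have E (m : nat) : \sum_(j < n) fund_weight k 0 j * (j == m :> nat)%:R
    = (m <= k)%N%:R.
  have [ltmn|lenm] := ltnP m n.
    rewrite (bigD1 (Ordinal ltmn)) //= eqxx mulr1 mxE big1 ?addr0 // => j.
    by rewrite -val_eqE => /negPf ->; exact: mulr0.
  rewrite big1 => [|j _]; first by rewrite leqNgt (leq_trans (ltn_ord k) lenm).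
  by rewrite ltn_eqF ?(leq_trans (ltn_ord j) lenm) //; exact: mulr0.
transitivity (((l <= k)%N%:R : int) - (l < k)%N%:R).
  by rewrite -!E -sumrB; apply: eq_bigr => j _; rewrite -mulrBr [simple_coroot _ _ _]mxE.
by rewrite -[in RHS]val_eqE /=; case: ltngtP => _; rewrite ?subrr ?subr0.
Qed.

(* [v] is a highest weight vector of weight [mu] for the Levi part. *)
Definition highest_weight_vector (F : fieldType) (n : nat) (M : lmodType F)
    (act : 'M[F]_(n + n) -> M -> M) (mu : weight n) (v : M) : Prop :=
  [/\ v != 0,
      forall u, Levi_unip u -> act u v = v
    & forall t : 'rV[F]_n, (forall j, t 0 j != 0) ->
        act (torus t) v = weight_char mu t *: v].

(* [W] is a copy of [E_mu] in [M]. *)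
Definition is_E (F : fieldType) (n : nat) (M : lmodType F)
    (act : 'M[F]_(n + n) -> M -> M) (mu : weight n) (W : M -> Prop) : Prop :=
  irreducible_submodule (@Pn F n) act W /\
  exists2 v, W v & highest_weight_vector act mu v.

(** * The tangent module [g / p_n] and its symmetric algebra *)

Definition tangent (F : fieldType) (n : nat) : vectType F := quot (sp F n) (pn F n).

Definition tangent_act (F : fieldType) (n : nat) (g : 'M[F]_(n + n))
    (w : tangent F n) : tangent F n :=
  quot_pi (sp F n) (pn F n) (g *m vsval w *m invmx g).

Definition sym_act (F : fieldType) (n : nat) (g : 'M[F]_(n + n)) :
    symAlg (tangent F n) -> symAlg (tangent F n) :=
  sym_map (tangent_act g).

(** * Fundamental highest weights *)

(* Every irreducible module of the Levi part occurs at most once in [Sym T]. *)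
Definition sym_multiplicity_free (F : fieldType) (n : nat) : Prop :=
  forall W1 W2 : symAlg (tangent F n) -> Prop,
    irreducible_submodule (@Levi F n) (@sym_act F n) W1 ->
    irreducible_submodule (@Levi F n) (@sym_act F n) W2 ->
    isomorphic_submodules (@Levi F n) (@sym_act F n) W1 W2 ->
    forall f, W1 f <-> W2 f.

(* [mu] is a fundamental highest weight of degree [d].  Both quantifiers refer
   to the same vector when [Sym T] is multiplicity free, since the highest
   weight vector of weight [mu] is then unique up to a scalar. *)
Definition fundamental_highest_weight (F : fieldType) (n : nat)
    (mu : weight n) (d : nat) : Prop :=
  (exists h, highest_weight_vector (@sym_act F n) mu h) /\
  (forall h, highest_weight_vector (@sym_act F n) mu h ->
     irreducible_mpoly h /\ Sym d h).

(* Main.v *)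
From HB Require Import structures.
From mathcomp Require Import perm.
Require Import Defs.
From mathcomp Require Import all_boot all_order all_algebra.
From mathcomp Require Import ssrcomplements mpoly complex.
From mathcomp Require Import reals.
From mathcomp Require Import ring zify.
From mathcomp Require boolp.

Set Implicit Arguments.
Unset Strict Implicit.
Unset Printing Implicit Defensive.
Import Order.TTheory GRing.Theory Num.Theory.
Local Open Scope ring_scope.

(** The tangent module [g / p_n] is the space of symmetric matrices [B], on which
    [Pn] acts through its Levi part [GL_n] by [B |-> a B a^T].  Hence an element
    [f] of its symmetric algebra is a polynomial function [ev Z f] of a matrix
    [Z] that only depends on the symmetric part of [Z], and the action reads
    [(g f)(Z) = f(a^T Z a)] ([ev_act]).

    The [k]-th leading minor of the generic symmetric matrix, [gen_minor k], is
    multiplied by the square of the [k]-th leading minor of [a] when [a] is upper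
    triangular, so it is a highest weight vector of weight [2 lambda_k], and a
    product of minors with exponents [e_k] has weight [sum_k 2 e_k lambda_k]
    ([hwv_mon_hwv]).  There are no others ([hwv_classification]): a symmetric
    matrix with nonzero leading minors is [u^T D u] with [u] upper unitriangular
    and [D] diagonal ([LDU_decomposition]), [D] is a square [t 1 t], so a highest
    weight vector is determined by its value at [1] and its weight.  Together
    with the existence of a highest weight vector in every nonzero submodule
    ([hwv_exists]) this gives multiplicity one.

    Complete reducibility comes from the Fischer pairing, [<p, q>] being the
    constant term of [p(d/dZ) q]: the adjoint of the action of [a] is the action of
    [a^T] ([fischer_msubst]), so the orthogonal of a submodule is a submodule.
    Products of minors have real coefficients, hence are not isotropic, so a
    submodule meets its orthogonal trivially: the intersection would contain a
    highest weight vector.  Consequently each product of minors generates an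
    irreducible submodule ([generated_irreducible]), and these submodules exhaust
    [Sym^r].  Two of them are orthogonal ([generated_perp]), because [<a h, h'>] vanishes
    for [a] in the dense set of products lower times diagonal times upper
    triangular.

    Finally [gen_minor k] is an irreducible polynomial ([gen_minor_irreducible]), as
    it has degree one in its last diagonal variable, and a product of minors is
    irreducible only if it is a single minor. *)

(** * Polynomials: generators, derivatives and zeros *)

Section Generators.
Variables (N : nat) (R : comNzRingType).
Implicit Types p q : {mpoly R[N]}.

(** Properties of ring morphisms on polynomials need only be checked on constants and
    variables. *)
Lemma mpoly_gen_ind (P : {mpoly R[N]} -> Prop) :
    (forall c, P c%:MP) -> (forall i, P 'X_i) ->
    (forall p q, P p -> P q -> P (p + q)) ->
    (forall p q, P p -> P q -> P (p * q)) ->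
  forall p, P p.
Proof.
move=> PC PX PD PM; elim/mpolyind => [|c m p _ _ IH].
  by rewrite -(mpolyC0 N R).
apply: (PD) => //; rewrite -mul_mpolyC; apply: (PM) => //.
rewrite mpolyXE_id; apply: big_ind => [|//|i _]; first exact: (PC 1).
by elim: (m i) => [|k IHk]; [exact: (PC 1) | rewrite exprS; apply: PM].
Qed.

(** Both sides are derivations along [h] that agree on generators.  Used for the
    univariate derivative along a line and for partial derivatives of a substitution. *)
Lemma chain_rule (S : comNzRingType) (h : {rmorphism {mpoly R[N]} -> S})
    (D : S -> S) :
    {morph D : x y / x + y} -> (forall x y, D (x * y) = D x * y + x * D y) ->
    (forall c, D (h c%:MP) = 0) ->
  forall p, D (h p) = \sum_i h p^`M(i) * D (h 'X_i).
Proof.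
move=> DD DM DC; apply: mpoly_gen_ind => [c|i|p q IHp IHq|p q IHp IHq].
- by rewrite DC big1 // => i _; rewrite mderivC rmorph0 mul0r.
- rewrite (bigD1 i) //= big1 ?addr0 => [|j ne_ji].
    have U0 : (U_(i) - U_(i) = 0 :> 'X_{1..N})%MM.
      by rewrite -{1}[U_(i)%MM]add0m addmK.
    by rewrite mderivX mnm1E eqxx scale1r U0 mpolyX0 rmorph1 mul1r.
  by rewrite mderivX mnm1E eq_sym (negPf ne_ji) scale0r rmorph0 mul0r.
- rewrite rmorphD DD IHp IHq -big_split /=; apply: eq_bigr => i _.
  by rewrite mderivD rmorphD mulrDl.
- rewrite rmorphM DM IHp IHq mulr_suml mulr_sumr -big_split /=.
  apply: eq_bigr => i _; rewrite mderivM rmorphD !rmorphM /= mulrDl.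
  by congr (_ + _); [rewrite mulrAC | rewrite mulrA].
Qed.

Lemma meval_at0 p : p.@[fun=> 0] = p@_0.
Proof.
move: p; apply: mpoly_gen_ind => [c|i|p q IHp IHq|p q IHp IHq].
- by rewrite mevalC mcoeffC eqxx mulr1.
- by rewrite mevalXU mcoeffX mnm1_eq0.
- by rewrite mevalD mcoeffD IHp IHq.
- by rewrite mevalM rmorphM /= IHp IHq.
Qed.

End Generators.

Lemma poly_vanish (F : numDomainType) (p : {poly F}) :
  (forall x, p.[x] = 0) -> p = 0.
Proof.
move=> p0; apply/eqP/negPn/negP => p_neq0.
(* The integers below [size p] would be too many roots. *)
pose rs := [seq i%:R : F | i <- iota 0 (size p)].
have: (size rs < size p)%N.
  apply: max_poly_roots p_neq0 _ _; first by apply/allP => x _; apply/rootP.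
  by rewrite map_inj_uniq ?iota_uniq // => i j /eqP; rewrite eqr_nat => /eqP.
by rewrite size_map size_iota ltnn.
Qed.

Section Vanishing.
Variables (N : nat) (F : numFieldType).
Implicit Types p q : {mpoly F[N]}.

Definition line_restr (x d : 'I_N -> F) p : {poly F} :=
  mmap (@polyC F) (fun i => (x i)%:P + d i *: 'X) p.

HB.instance Definition _ x d :=
  GRing.RMorphism.copy (line_restr x d) (line_restr x d).

Lemma line_restrE x d p s : (line_restr x d p).[s] = p.@[fun i => x i + d i * s].
Proof.
move: p; apply: mpoly_gen_ind => [c|i|p q IHp IHq|p q IHp IHq].
- by rewrite /line_restr mmapC hornerC mevalC.
- by rewrite /line_restr mmapX mmap1U mevalXU !hornerE.
- by rewrite [line_restr _ _ _]rmorphD hornerD IHp IHq mevalD.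
- by rewrite [line_restr _ _ _]rmorphM hornerM IHp IHq mevalM.
Qed.

Lemma mderiv_vanish p v : (forall x, p.@[x] = 0) -> forall x, p^`M(v).@[x] = 0.
Proof.
move=> p0 x; pose d i : F := (i == v)%:R.
have lp0 : line_restr x d p = 0.
  by apply: poly_vanish => s; rewrite line_restrE p0.
have dC c : (line_restr x d c%:MP)^`() = 0 by rewrite /line_restr mmapC derivC.
have dX i : (line_restr x d 'X_i)^`() = (d i)%:P.
  by rewrite /line_restr mmapX mmap1U derivD derivC derivZ derivX add0r alg_polyC.
have : \sum_i line_restr x d p^`M(i) * (line_restr x d 'X_i)^`() = 0.
  apply: etrans (esym (chain_rule (@derivD F) (@derivM F) dC p)) _.
  by rewrite /= lp0 deriv0.
rewrite (bigD1 v) //= big1 ?addr0 => [|i ne_iv]; last first.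
  by rewrite dX /d (negPf ne_iv) mulr0.
rewrite dX /d eqxx mulr1 => /(congr1 (fun q : {poly F} => q.[0])).
rewrite horner0 line_restrE => E; rewrite -[RHS]E; apply: meval_eq => i.
by rewrite mulr0 addr0.
Qed.

(** If [p] vanishes everywhere, so do its partial derivatives, which vanish
    identically by induction on the degree; in characteristic zero [p] is then constant. *)
Lemma mpoly_vanish p : (forall x, p.@[x] = 0) -> p = 0.
Proof.
have : forall m, (msize p <= mdeg m)%N -> p@_m = 0.
  by move=> m /msize_mdeg_ge /memN_msupp_eq0.
move: (msize p) => k; elim: k p => [|k IH] p degp p0.
  by apply/mpolyP => m; rewrite degp ?mcoeff0.
have dp0 v : p^`M(v) = 0.
  apply: IH => [m le_km|]; last exact: mderiv_vanish.
  by rewrite mcoeff_deriv degp ?mul0rn // mdegD mdeg1 addn1.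
apply/mpolyP => m; rewrite mcoeff0.
have [->|] := eqVneq m 0%MM; first by rewrite -meval_at0 p0.
rewrite -mdeg_eq0 mdegE sum_nat_eq0 negb_forall => /existsP [v /= nz_mv].
have := congr1 (mcoeff (m - U_(v))) (dp0 v).
rewrite mcoeff_deriv mcoeff0 submK; last first.
  by apply/mnm_lepP => i; rewrite mnm1E; case: eqP => // <-; rewrite lt0n.
by move/eqP; rewrite mulrn_eq0 /= => /eqP.
Qed.

End Vanishing.

Section DHomog.
Variables (N : nat) (R : nzRingType).

Lemma dhomog_bigprod (I : Type) (r : seq I) (P : pred I) (d : I -> nat)
    (f : I -> {mpoly R[N]}) :
  (forall i, P i -> f i \is (d i).-homog) ->
  \prod_(i <- r | P i) f i \is (\sum_(i <- r | P i) d i)%N.-homog.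
Proof.
move=> fP; elim: r => [|i r IH]; first by rewrite !big_nil dhomog1.
by rewrite !big_cons; case: ifP => // /fP fi; apply: dhomogM.
Qed.

End DHomog.

(** * Linear substitutions and the Fischer pairing *)

Section LinearSubstitution.
Variable F : comNzRingType.

(** The algebra morphism that extends a linear map between the spaces of variables:
    [L] sends the variable [v] to the linear form given by its column [v]. *)
Definition msubst (M N : nat) (L : 'M[F]_(M, N)) : {mpoly F[N]} -> {mpoly F[M]} :=
  comp_mpoly [tuple \sum_(w < M) L w v *: 'X_w | v < N].

HB.instance Definition _ M N (L : 'M[F]_(M, N)) :=
  GRing.RMorphism.copy (msubst L) (msubst L).
HB.instance Definition _ M N (L : 'M[F]_(M, N)) :=
  GRing.Linear.copy (msubst L) (msubst L).

Lemma msubstX M N (L : 'M[F]_(M, N)) v : msubst L 'X_v = \sum_w L w v *: 'X_w.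
Proof. by rewrite /msubst comp_mpolyXU -tnth_nth tnth_mktuple. Qed.

Lemma msubst_meval M N (L : 'M[F]_(M, N)) p x :
  (msubst L p).@[x] = p.@[fun v => \sum_w L w v * x w].
Proof.
rewrite comp_mpoly_meval; apply: meval_eq => v; rewrite tnth_mktuple.
by rewrite raddf_sum /=; apply: eq_bigr => w _; rewrite mevalZ mevalXU.
Qed.

Lemma dhomog_msubst M N (L : 'M[F]_(M, N)) r p :
  p \is r.-homog -> msubst L p \is r.-homog.
Proof.
move=> /dhomogP homp; rewrite /msubst comp_mpolyEX big_seq.
apply: rpred_sum => m /homp /= <-; apply: rpredZ; rewrite comp_mpolyX mdegE.
apply: dhomog_bigprod => v _; rewrite -[X in X.-homog]mul1n; apply: dhomogMn.
rewrite tnth_mktuple; apply: rpred_sum => w _; apply: rpredZ.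
by rewrite dhomogX /= mdeg1.
Qed.

Lemma mderiv_msubst M N (L : 'M[F]_(M, N)) p w :
  (msubst L p)^`M(w) = \sum_v L w v *: msubst L p^`M(v).
Proof.
rewrite [LHS](chain_rule (h := msubst L) (D := mderiv w)); last first.
- by move=> c; rewrite /= /msubst comp_mpolyC mderivC.
- exact: mderivM.
- exact: mderivD.
apply: eq_bigr => v _; suff dX : (msubst L 'X_v)^`M(w) = (L w v)%:MP.
  by rewrite -mul_mpolyC mulrC -dX.
rewrite msubstX (linear_sum (mderiv w)).
rewrite (bigD1 w) //= [X in _ + X]big1 => [|i ne_iw]; last first.
  by rewrite mderivZ mderivX mnm1E (negPf ne_iw) !(scale0r, scaler0).
have U0 : (U_(w) - U_(w) = 0 :> 'X_{1..M})%MM by rewrite -{1}[U_(w)%MM]add0m addmK.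
by rewrite addr0 mderivZ mderivX mnm1E eqxx U0 mpolyX0 scale1r alg_mpolyC.
Qed.

End LinearSubstitution.

Section Fischer.
Variable F : comNzRingType.

Definition mfact N (m : 'X_{1..N}) : nat := \prod_i (m i)`!.

(** The constant term of [p(d/dX) q]; distinct monomials are orthogonal. *)
Definition fischer N (p q : {mpoly F[N]}) : F :=
  \sum_(m <- msupp p) p@_m * q@_m * (mfact m)%:R.

Section Bilinear.
Variable N : nat.
Implicit Types p q : {mpoly F[N]}.

Lemma fischerE k p q : (msize p <= k)%N ->
  fischer p q = \sum_(m : 'X_{1..N < k}) p@_m * q@_m * (mfact m)%:R.
Proof.
move=> le_pk; rewrite /fischer (big_mksub 'X_{1..N < k}) ?msupp_uniq //=.
  by rewrite big_rmcond //= => m /memN_msupp_eq0 ->; rewrite !mul0r.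
by move=> m /msize_mdeg_lt /leq_trans; apply.
Qed.

Lemma fischerC p q : fischer p q = fischer q p.
Proof.
rewrite (fischerE _ (leq_maxl _ (msize q))) (fischerE _ (leq_maxr (msize p) _)).
by apply: eq_bigr => m _; rewrite [p@__ * _]mulrC.
Qed.

Lemma fischer_is_linear p : scalar (fischer p).
Proof.
move=> a q q'; rewrite /fischer mulr_sumr -big_split /=; apply: eq_bigr => m _.
by rewrite mcoeffD mcoeffZ mulrDr mulrDl mulrCA !mulrA.
Qed.

HB.instance Definition _ p := GRing.isLinear.Build F {mpoly F[N]} F *%R
  (fischer p) (fischer_is_linear p).

Lemma fischerX m q : fischer 'X_[m] q = q@_m * (mfact m)%:R.
Proof. by rewrite /fischer msuppX big_seq1 mcoeffX eqxx mul1r. Qed.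

(** Multiplication by a variable is adjoint to the corresponding partial derivative. *)
Lemma fischer_mulX v p q : fischer ('X_v * p) q = fischer p q^`M(v).
Proof.
rewrite fischerC [RHS]fischerC; elim/mpolyind: p => [|c m p _ _ IH].
  by rewrite mulr0 !linear0.
rewrite mulrDr !linearD /= {}IH; congr (_ + _).
rewrite -scalerAr !linearZ /=; congr (_ * _).
rewrite -mpolyXD fischerC [RHS]fischerC !fischerX mcoeff_deriv addmC.
rewrite mulrnAl -mulrnAr -mulrnA; congr (_ * _%:R).
rewrite /mfact (bigD1 v) //= [in RHS](bigD1 v) //= mnmDE mnm1E eqxx addn1.
rewrite factS [(_ * (m v).+1)%N]mulnC mulnA; congr (_ * _)%N.
by apply: eq_bigr => i ne_iv; rewrite mnmDE mnm1E eq_sym (negPf ne_iv) addn0.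
Qed.

End Bilinear.

(** By induction on [p]: the case of a product with a variable is the chain rule,
    since multiplication by a variable is adjoint to its derivative. *)
Lemma fischer_msubst M N (L : 'M[F]_(M, N)) p q :
  fischer (msubst L p) q = fischer p (msubst L^T q).
Proof.
(* The statement for [p] is strengthened to: multiplication by [p] preserves adjunction. *)
suff: forall p', (forall q, fischer (msubst L p') q = fischer p' (msubst L^T q)) ->
    forall q, fischer (msubst L (p * p')) q = fischer (p * p') (msubst L^T q).
  move=> adjM; rewrite -[p]mulr1; apply: adjM => {}q.
  have fischer1 K (f : {mpoly F[K]}) : fischer 1 f = f@_0.
    by rewrite -mpolyX0 fischerX /mfact big1 ?mulr1 // => i _; rewrite mnm0E.
  rewrite rmorph1 !fischer1 -!meval_at0 msubst_meval.
  by apply: meval_eq => v; rewrite big1 // => w _; rewrite mulr0.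
move: p; apply: mpoly_gen_ind => [c|i|p1 p2 IH1 IH2|p1 p2 IH1 IH2] p' adj' {}q.
- by rewrite mul_mpolyC fischerC [RHS]fischerC !linearZ /= fischerC adj' fischerC.
- rewrite rmorphM /= msubstX fischer_mulX mderiv_msubst mulr_suml fischerC !linear_sum.
  apply: eq_bigr => w _.
  by rewrite -scalerAl !linearZ /= fischerC fischer_mulX adj' mxE.
- rewrite mulrDl fischerC [RHS]fischerC !linearD /= !(fischerC q).
  by rewrite IH1 // IH2 // !(fischerC (msubst _ _)).
- by rewrite -mulrA; apply: IH1; apply: IH2.
Qed.

End Fischer.

(** The pairing of a real polynomial with itself is a sum of squares with positive
    weights. *)
Lemma fischer_real (F : numFieldType) N (p : {mpoly F[N]}) :
  p \is a mpolyOver N (@Num.Def.real_num_pred F) -> fischer p p = 0 -> p = 0.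
Proof.
move=> /mpolyOverP rp; rewrite /fischer => /eqP.
rewrite psumr_eq0 => [/allP sp0|m _]; last first.
  by rewrite mulr_ge0 ?ler0n // -expr2 real_exprn_even_ge0 // rp.
apply/mpolyP => m; rewrite mcoeff0; apply/eqP/negPn/negP => pm.
have := sp0 m; rewrite mcoeff_msupp pm => /(_ isT).
rewrite -expr2 mulf_eq0 expf_eq0 (negPf pm) pnatr_eq0 /= -leqn0 leqNgt.
by rewrite prodn_gt0 // => i; rewrite fact_gt0.
Qed.

(** * The tangent module as a space of symmetric matrices *)

Section Symplectic.
Variables (F : fieldType) (n : nat).
Local Notation J := (sympJ F n).

Lemma sympJ_sqr : J *m J = - 1%:M.
Proof.
rewrite /sympJ mulmx_block !(mulmxN, mulNmx, mul0mx, mulmx0, mul1mx, oppr0) !(add0r, addr0).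
by rewrite (scalar_mx_block n n) opp_block_mx !oppr0.
Qed.

Lemma sympJ_tr : J^T = - J.
Proof.
by rewrite /sympJ tr_block_mx opp_block_mx !linear0 linearN /= trmx1 opprK.
Qed.

(** The inverse is written with [J] so that its blocks can be read off. *)
Lemma Sp_invmx (g : 'M[F]_(n + n)) : Sp g -> invmx g = - (J *m g^T *m J) /\ g \in unitmx.
Proof.
move=> Spg; have gK : - (J *m g^T *m J) *m g = 1%:M.
  by rewrite mulNmx -!mulmxA (mulmxA g^T) Spg sympJ_sqr opprK.
have gU := proj2 (mulmx1_unit gK).
by split=> //; rewrite -[LHS]mul1mx -gK mulmxK.
Qed.

Lemma sp_conj (g x : 'M[F]_(n + n)) : Sp g -> x \in sp F n ->
  g *m x *m invmx g \in sp F n.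
Proof.
move=> Spg; rewrite !mem_sp (proj1 (Sp_invmx Spg)) => /eqP xsp.
(* The equation of [sp], conjugated by [J]. *)
have Jx : J *m x^T = - (x *m J).
  have /(congr1 (fun y => J *m y *m J)) := xsp.
  rewrite mulmxDr mulmxDl mulmx0 mul0mx !mulmxA sympJ_sqr mulNmx mul1mx mulNmx.
  rewrite -(mulmxA _ J J) sympJ_sqr mulmxN mulmx1 -opprD => /eqP.
  by rewrite oppr_eq0 addr_eq0 => /eqP.
rewrite mulmxN linearN /= mulNmx mulmxN !trmx_mul trmxK sympJ_tr.
rewrite !(mulNmx, mulmxN) !opprK !mulmxA.
rewrite -(mulmxA (J *m g) J) Jx !(mulNmx, mulmxN) !mulmxA.
by rewrite opprK subrr.
Qed.
End Symplectic.

Lemma Pn_blocks (F : fieldType) (n : nat) (g : 'M[F]_(n + n)) : Pn g ->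
  [/\ g \in unitmx, drsubmx (invmx g) = (ulsubmx g)^T, ursubmx (invmx g) = 0
    & ulsubmx g \in unitmx].
Proof.
case=> Spg ur0; have [gV gU] := Sp_invmx Spg.
pose a := ulsubmx g; pose c := dlsubmx g; pose d := drsubmx g.
have gE : g = block_mx a 0 c d by rewrite -ur0 submxK.
have gVE : invmx g = block_mx d^T 0 (- c^T) a^T.
  rewrite gV gE tr_block_mx /sympJ !mulmx_block trmx0.
  rewrite !(mulmxN, mulNmx, mul0mx, mulmx0, mul1mx, mulmx1, oppr0) !(add0r, addr0).
  by rewrite opp_block_mx !opprK oppr0.
have aU : a \in unitmx.
  have := mulVmx gU; rewrite gVE gE mulmx_block (scalar_mx_block n n).
  by move=> /eq_block_mx [+ _ _ _]; rewrite mul0mx addr0 => /mulmx1_unit [].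
by split=> //; rewrite gVE ?block_mxKdr ?block_mxKur.
Qed.

Section TangentModel.
Variables (F : numFieldType) (n : nat).
Local Notation T := (tangent F n).
Local Notation N := (\dim {:T}).

Definition tan_mx (w : T) : 'M[F]_n := ursubmx (vsval w).

Lemma tan_mx_is_linear : linear tan_mx.
Proof. by move=> a u v; rewrite /tan_mx !linearP. Qed.

HB.instance Definition _ := GRing.isLinear.Build F T 'M[F]_n _ tan_mx tan_mx_is_linear.

Lemma pn_sub_sp : (pn F n <= sp F n)%VS.
Proof. by apply/subvP => x; rewrite mem_pn => /andP []. Qed.

Lemma tan_mx_quot x : x \in sp F n ->
  tan_mx (quot_pi (sp F n) (pn F n) x) = ursubmx x.
Proof.
move=> xsp; have memD : addv_pi1 (sp F n) (pn F n) x \in (sp F n :\: pn F n)%VS.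
  exact: memv_pi.
have xUV : x \in (sp F n + pn F n)%VS by rewrite (subvP (addvSl _ _)).
rewrite -{2}(addv_pi1_pi2 xUV) linearD /= /tan_mx /quot_pi vsprojK //.
have : addv_pi2 (sp F n) (pn F n) x \in pn F n by exact: memv_pi2.
by rewrite mem_pn => /andP [_ /eqP ->]; rewrite addr0.
Qed.

Lemma tan_sp (w : T) : vsval w \in sp F n.
Proof. exact: subvP (diffvSl _ _) _ (subvsP w). Qed.

Lemma tan_mx_inj : injective tan_mx.
Proof.
move=> u v /eqP; rewrite -subr_eq0 -linearB => /eqP uv0.
apply/eqP; rewrite -subr_eq0 -[u - v]quot_piK quot_pi_eq0 ?pn_sub_sp ?tan_sp //.
by rewrite mem_pn tan_sp; apply/eqP.
Qed.

Lemma ur_block_sp (B : 'M[F]_n) : (block_mx 0 B 0 0 \in sp F n) = (B^T == B).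
Proof.
rewrite mem_sp /sympJ tr_block_mx !mulmx_block !trmx0.
rewrite !(mulmxN, mulNmx, mul0mx, mulmx0, mul1mx, mulmx1, oppr0) !(add0r, addr0).
rewrite add_block_mx !(add0r, addr0) -(block_mx0 F n n n n).
by apply/eqP/eqP => [/eq_block_mx [_ _ _ /eqP]|->]; rewrite ?subr_eq0 ?subrr // => /eqP.
Qed.

Lemma tan_mx_tr (w : T) : (tan_mx w)^T = tan_mx w.
Proof.
have := tan_sp w; rewrite -[vsval w]submxK mem_sp /sympJ tr_block_mx !mulmx_block add_block_mx.
rewrite -(block_mx0 F n n n n) => /eqP /eq_block_mx [_ _ _].
rewrite !(mulmxN, mulNmx, mul0mx, mulmx0, mul1mx, mulmx1, oppr0) !(add0r, addr0).
by move/eqP; rewrite subr_eq0 => /eqP.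
Qed.

Definition sym_part (B : 'M[F]_n) : 'M[F]_n := 2^-1 *: (B + B^T).

Lemma sym_part_is_linear : linear sym_part.
Proof.
move=> a u v; rewrite /sym_part linearP /= scalerA mulrC -scalerA -scalerDr.
by congr (_ *: _); rewrite scalerDr addrACA.
Qed.
HB.instance Definition _ := GRing.isLinear.Build F 'M[F]_n 'M[F]_n _ sym_part sym_part_is_linear.

Lemma sym_part_tr B : (sym_part B)^T = sym_part B.
Proof. by rewrite /sym_part linearZ linearD /= trmxK addrC. Qed.

Lemma sym_part_id B : B^T = B -> sym_part B = B.
Proof.
move=> BT; rewrite /sym_part BT -mulr2n -scaler_nat scalerA mulVf ?scale1r //.
by rewrite pnatr_eq0.
Qed.

(** The tangent vector with given symmetric part; every matrix is a legal argument,
    which makes [mx_tan] linear on all matrices. *)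
Definition mx_tan (B : 'M[F]_n) : T :=
  quot_pi (sp F n) (pn F n) (block_mx 0 (sym_part B) 0 0).

Lemma mx_tanK B : tan_mx (mx_tan B) = sym_part B.
Proof.
by rewrite tan_mx_quot ?block_mxKur // ur_block_sp sym_part_tr.
Qed.

Lemma tan_mxK : cancel tan_mx mx_tan.
Proof. by move=> w; apply: tan_mx_inj; rewrite mx_tanK sym_part_id ?tan_mx_tr. Qed.

Lemma mx_tan_is_linear : linear mx_tan.
Proof. by move=> a u v; apply: tan_mx_inj; rewrite linearP /= !mx_tanK linearP. Qed.
HB.instance Definition _ := GRing.isLinear.Build F 'M[F]_n T _ mx_tan mx_tan_is_linear.

Lemma tan_mx_act g w : Pn g ->
  tan_mx (tangent_act g w) = ulsubmx g *m tan_mx w *m (ulsubmx g)^T.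
Proof.
move=> Pg; have [gU gV gV0 _] := Pn_blocks Pg; case: Pg => Spg ur0.
rewrite tan_mx_quot ?sp_conj ?tan_sp // /tan_mx.
rewrite -{1}[invmx g]submxK -{1}[g]submxK -{1}[vsval w]submxK !mulmx_block block_mxKur.
by rewrite ur0 gV0 gV mulmx0 add0r mul0mx addr0.
Qed.

Local Notation b i := (tnth (vbasis {:T}) i).

Definition coord_mx : 'M[F]_(n * n, N) := \matrix_(v, i) mxvec (tan_mx (b i)) 0 v.

(** A tangent vector [w] becomes the linear form [Z |-> sum_(k, l) w_kl Z_kl] in the
    [n * n] independent entries of a matrix [Z].  All [n * n] entries are used, rather
    than coordinates on symmetric matrices, so that they are orthonormal for the Fischer
    pairing without normalizing the off-diagonal ones. *)
Definition iota_mx : symAlg T -> {mpoly F[n * n]} := msubst coord_mx.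

HB.instance Definition _ := GRing.RMorphism.copy iota_mx iota_mx.
HB.instance Definition _ := GRing.Linear.copy iota_mx iota_mx.

Definition act_mx (g : T -> T) : 'M[F]_N := \matrix_(j, i) coord (vbasis {:T}) j (g (b i)).

Lemma sym_mapE g f : sym_map g f = msubst (act_mx g) f.
Proof.
rewrite /sym_map /msubst; congr (_ \mPo _).
by apply: eq_from_tnth => i; rewrite !tnth_mktuple /sym_in; apply: eq_bigr => j _; rewrite mxE.
Qed.

Lemma coord_mx_sum w v :
  \sum_j coord_mx v j * coord (vbasis {:T}) j w = mxvec (tan_mx w) 0 v.
Proof.
rewrite {2}(coord_vbasis (memvf w)) 2!linear_sum summxE; apply: eq_bigr => j _.
by rewrite !linearZ /= !mxE mulrC (tnth_nth 0).
Qed.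

End TangentModel.

(** * Symmetric powers as polynomial functions on matrices *)

Lemma mxvec_sum (R : nzRingType) (m n : nat) (A B : 'M[R]_(m, n)) :
  \sum_v mxvec A 0 v * mxvec B 0 v = \sum_i \sum_j A i j * B i j.
Proof.
rewrite pair_bigA (reindex _ (curry_mxvec_bij m n)) /=.
by apply: eq_bigr => -[i j] _ /=; rewrite !mxvecE.
Qed.

Lemma msubst_comp (F : comNzRingType) (M N K : nat) (L : 'M[F]_(M, N))
    (L' : 'M[F]_(N, K)) p : msubst L (msubst L' p) = msubst (L *m L') p.
Proof.
move: p; apply: mpoly_gen_ind => [c|i|p q IHp IHq|p q IHp IHq].
- by rewrite /msubst !comp_mpolyC.
- rewrite !msubstX linear_sum /=.
  under eq_bigr => w _ do rewrite linearZ /= msubstX scaler_sumr.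
  rewrite exchange_big /=; apply: eq_bigr => w _; rewrite mxE scaler_suml.
  by apply: eq_bigr => j _; rewrite scalerA mulrC.
- by rewrite !linearD /= IHp IHq.
- by rewrite !rmorphM /= IHp IHq.
Qed.

Lemma msubst1 (F : comNzRingType) (N : nat) (p : {mpoly F[N]}) : msubst 1%:M p = p.
Proof.
move: p; apply: mpoly_gen_ind => [c|i|p q IHp IHq|p q IHp IHq].
- by rewrite /msubst !comp_mpolyC.
- rewrite !msubstX (bigD1 i) //= big1 ?addr0 => [|j ne_ji]; first by rewrite mxE eqxx scale1r.
  by rewrite mxE (negPf ne_ji) scale0r.
- by rewrite !linearD /= IHp IHq.
- by rewrite !rmorphM /= IHp IHq.
Qed.

Section MatrixAction.
Variables (F : comNzRingType) (n : nat).

(** The matrix, acting on rows, of [Z |-> a^T Z a]. *)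
Definition conj_mx (a : 'M[F]_n) : 'M[F]_(n * n) :=
  lin_mx (mulmx a^T \o mulmxr a).

Lemma mul_conj_mx a Z : mxvec Z *m conj_mx a = mxvec (a^T *m Z *m a).
Proof. by rewrite /conj_mx mul_vec_lin /= mulmxA. Qed.

Lemma conj_mxE a k l p q :
  conj_mx a (mxvec_index k l) (mxvec_index p q) = a k p * a l q.
Proof.
have -> : conj_mx a (mxvec_index k l) (mxvec_index p q) =
    row (mxvec_index k l) (conj_mx a) 0 (mxvec_index p q) by rewrite [RHS]mxE.
rewrite rowE -mxvec_delta mul_conj_mx mxvecE -(mul_delta_mx (0 : 'I_1)).
by rewrite mulmxA -colE -mulmxA -rowE mxE big_ord1 !mxE.
Qed.

(** This is what makes [GL_n] closed under adjoints for the Fischer pairing. *)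
Lemma conj_mx_tr a : (conj_mx a)^T = conj_mx a^T.
Proof.
apply/matrixP => v w; case/mxvec_indexP: v => k l; case/mxvec_indexP: w => p q.
by rewrite mxE !conj_mxE !mxE.
Qed.

Definition mxval (p : {mpoly F[n * n]}) (Z : 'M[F]_n) : F := p.@[fun v => mxvec Z 0 v].

Lemma mxval_conj a p Z : mxval (msubst (conj_mx a) p) Z = mxval p (a^T *m Z *m a).
Proof.
rewrite /mxval msubst_meval; apply: meval_eq => v; rewrite -mul_conj_mx mxE.
by apply: eq_bigr => w _; rewrite mulrC.
Qed.

Lemma conj_mxM a b : conj_mx a *m conj_mx b = conj_mx (a *m b).
Proof.
apply/row_matrixP => v; rewrite !rowE -[delta_mx 0 v]vec_mxK mulmxA.
by rewrite !mul_conj_mx trmx_mul !mulmxA.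
Qed.

End MatrixAction.

Section Model.
Variables (F : numFieldType) (n : nat).
Local Notation T := (tangent F n).
Local Notation N := (\dim {:T}).
Local Notation S := (symAlg T).
Implicit Types (f : S) (Z : 'M[F]_n) (g : 'M[F]_(n + n)).

Lemma sym_actE g f : sym_act g f = msubst (act_mx (tangent_act g)) f.
Proof. exact: sym_mapE. Qed.

Lemma iota_act g f : Pn g ->
  iota_mx (sym_act g f) = msubst (conj_mx (ulsubmx g)) (iota_mx f).
Proof.
move=> Pg; rewrite sym_actE /iota_mx !msubst_comp; congr (msubst _ _).
apply/matrixP => v i; rewrite mxE.
under eq_bigr => j _ do rewrite [act_mx _ _ _]mxE.
rewrite coord_mx_sum tan_mx_act // -{1}[ulsubmx g]trmxK -mul_conj_mx -conj_mx_tr !mxE.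
by apply: eq_bigr => w _; rewrite !mxE mulrC.
Qed.

(** A left inverse of [coord_mx], sending the entry [Z_kl] to the symmetric part of the
    elementary matrix [E_kl]. *)
Definition coord_inv_mx : 'M[F]_(N, n * n) :=
  \matrix_(i, v) coord (vbasis {:T}) i (mx_tan (vec_mx (delta_mx 0 v))).

Lemma coord_mxK : coord_inv_mx *m coord_mx F n = 1%:M.
Proof.
apply/matrixP => i j; rewrite mxE [RHS]mxE eq_sym.
rewrite -(coord_free _ _ (basis_free (vbasisP {:T}))) -tnth_nth.
rewrite -[tnth _ j in RHS]tan_mxK -[tan_mx _]mxvecK [mxvec _]row_sum_delta !linear_sum /=.
by apply: eq_bigr => v _; rewrite !linearZ /= !mxE mulrC.
Qed.

Lemma iota_mx_inj : injective (@iota_mx F n).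
Proof.
apply: (can_inj (g := msubst coord_inv_mx)) => f.
by rewrite /iota_mx msubst_comp coord_mxK msubst1.
Qed.

(** The value at [Z] of the polynomial function attached to [f]. *)
Definition ev Z f : F := mxval (iota_mx f) Z.

Lemma ev_is_zmod_morphism Z : zmod_morphism (ev Z).
Proof. by move=> f f'; rewrite /ev /mxval !rmorphB. Qed.

Lemma ev_is_monoid_morphism Z : monoid_morphism (ev Z).
Proof.
by split=> [|f f']; rewrite /ev /mxval ?rmorph1 // !rmorphM.
Qed.

HB.instance Definition _ Z := GRing.isZmodMorphism.Build S F (ev Z) (@ev_is_zmod_morphism Z).
HB.instance Definition _ Z := GRing.isMonoidMorphism.Build S F (ev Z) (@ev_is_monoid_morphism Z).

Lemma evZ Z c f : ev Z (c *: f) = c * ev Z f.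
Proof. by rewrite /ev /mxval linearZ /= mevalZ. Qed.

Lemma ev_act g f Z : Pn g ->
  ev Z (sym_act g f) = ev ((ulsubmx g)^T *m Z *m ulsubmx g) f.
Proof. by move=> Pg; rewrite /ev iota_act // mxval_conj. Qed.

Lemma sym_partE Z k l : sym_part Z k l = 2^-1 * (Z k l + Z l k).
Proof. by rewrite /sym_part !mxE. Qed.

(** Symmetrization is self-adjoint for the trace pairing. *)
Lemma sym_part_adjoint (A B : 'M[F]_n) :
  \sum_k \sum_l sym_part A k l * B k l = \sum_k \sum_l A k l * sym_part B k l.
Proof.
transitivity (2^-1 * (\sum_k \sum_l A k l * B k l + \sum_k \sum_l A k l * B l k)).
  rewrite [X in _ + X]exchange_big /= -big_split mulr_sumr; apply: eq_bigr => k _.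
  rewrite -big_split mulr_sumr; apply: eq_bigr => l _.
  by rewrite sym_partE /= -mulrDl mulrA.
rewrite -big_split mulr_sumr; apply: eq_bigr => k _.
rewrite -big_split mulr_sumr; apply: eq_bigr => l _.
by rewrite sym_partE /= -mulrDr mulrCA.
Qed.

Lemma ev_sym_part f Z : ev Z f = ev (sym_part Z) f.
Proof.
rewrite /ev /mxval /iota_mx !msubst_meval; apply: meval_eq => i.
under eq_bigr do rewrite mxE; under [RHS]eq_bigr do rewrite mxE.
by rewrite !mxvec_sum -sym_part_adjoint sym_part_id ?tan_mx_tr.
Qed.

(** Values at symmetric matrices suffice by [ev_sym_part]. *)
Lemma ev_eq0 f : (forall Z, Z^T = Z -> ev Z f = 0) -> f = 0.
Proof.
move=> f0; apply: iota_mx_inj; rewrite linear0; apply: mpoly_vanish => x.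
have := f0 (sym_part (vec_mx (\row_v x v))); rewrite sym_part_tr -ev_sym_part => /(_ erefl) E.
by rewrite -[RHS]E; apply: meval_eq => v; rewrite vec_mxK mxE.
Qed.

Lemma iota_sym_in w :
  iota_mx (sym_in w) = \sum_v mxvec (tan_mx w) 0 v *: ('X_v : {mpoly F[n * n]}).
Proof.
rewrite /sym_in (linear_sum (@iota_mx F n)).
under eq_bigr => i _ do rewrite linearZ /= /iota_mx msubstX scaler_sumr.
rewrite exchange_big /=; apply: eq_bigr => v _.
rewrite -coord_mx_sum scaler_suml; apply: eq_bigr => j _.
by rewrite scalerA mulrC.
Qed.

Lemma ev_sym_in w Z : ev Z (sym_in w) = \sum_k \sum_l tan_mx w k l * Z k l.
Proof.
rewrite -mxvec_sum /ev /mxval iota_sym_in raddf_sum.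
by apply: eq_bigr => v _; rewrite /= mevalZ mevalXU.
Qed.

End Model.

(** * Leading minors and triangular factorization *)

Section LeadingMinors.
Variables (R : comNzRingType) (n : nat).
Implicit Types (k : nat) (M l u : 'M[R]_n).

Definition lower_tri M := forall i j : 'I_n, (i < j)%N -> M i j = 0.
(** The diagonal and the entries below it are those of the identity; this is the form in
    which [Levi_unip] constrains the upper left block. *)
Definition upper_unitri M := forall i j : 'I_n, (j <= i)%N -> M i j = (i == j)%:R.

(** The leading block of size [k], completed by the identity so that it keeps the size of
    [M]; its determinant is the leading minor. *)
Definition trunc_mx k M : 'M[R]_n :=
  \matrix_(i, j) if (i < k)%N && (j < k)%N then M i j else (i == j)%:R.

Definition lminor k M : R := \det (trunc_mx k M).

Lemma trunc_mx_tr k M : trunc_mx k M^T = (trunc_mx k M)^T.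
Proof. by apply/matrixP=> i j; rewrite !mxE andbC eq_sym. Qed.

Lemma lminor_tr k M : lminor k M^T = lminor k M.
Proof. by rewrite /lminor trunc_mx_tr det_tr. Qed.

(** A row of index less than [k] of a lower triangular matrix only involves columns of
    index less than [k]. *)
Lemma trunc_mx_mulr k l M : lower_tri l ->
  trunc_mx k (l *m M) = trunc_mx k l *m trunc_mx k M.
Proof.
move=> lowl; apply/matrixP=> i j; rewrite !mxE.
have [lt_ik|le_ki] /= := ltnP i k; last first.
  rewrite (bigD1 i) //= big1 ?addr0 => [|p ne_pi]; last first.
    by rewrite !mxE ltnNge le_ki eq_sym (negPf ne_pi) mul0r.
  by rewrite !mxE ltnNge le_ki eqxx mul1r.
have [lt_jk|le_kj] := ltnP j k.
  apply: eq_bigr => p _; rewrite !mxE lt_ik lt_jk /= andbT.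
  by case: ltnP => // le_kp; rewrite lowl ?mul0r ?(leq_trans lt_ik) // [i == p]ltn_eqF ?mul0r // (leq_trans lt_ik).
rewrite (bigD1 j) //= big1 ?addr0 => [|p ne_pj]; last first.
  by rewrite !mxE [(j < k)%N]ltnNge le_kj andbF (negPf ne_pj) mulr0.
by rewrite !mxE [(j < k)%N]ltnNge le_kj !andbF eqxx mulr1.
Qed.

Lemma lminor_mulr k l M : lower_tri l -> lminor k (l *m M) = lminor k l * lminor k M.
Proof. by move=> ll; rewrite /lminor trunc_mx_mulr // det_mulmx. Qed.

Lemma lminor_lower k l : lower_tri l -> lminor k l = \prod_(i < n | (i < k)%N) l i i.
Proof.
move=> ll; rewrite /lminor det_trig; last first.
  apply/is_trig_mxP => i j lt_ij; rewrite mxE ll //.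
  by rewrite [i == j]ltn_eqF //; case: ifP.
rewrite [RHS]big_mkcond /=; apply: eq_bigr => i _.
by rewrite mxE eqxx andbb.
Qed.

Lemma lower_unitri_tri M : upper_unitri M^T -> lower_tri M.
Proof.
by move=> uM i j lt_ij; have := uM j i (ltnW lt_ij); rewrite mxE [j == i]gtn_eqF.
Qed.

Lemma lminor_unitri k M : upper_unitri M -> lminor k M = 1.
Proof.
move=> uM; rewrite -lminor_tr lminor_lower.
  by rewrite big1 // => i _; rewrite mxE uM // eqxx.
by apply: lower_unitri_tri; rewrite trmxK.
Qed.

Lemma lminor_congr k a M : lower_tri a^T ->
  lminor k (a^T *m M *m a) = (\prod_(i < n | (i < k)%N) a i i) ^+ 2 * lminor k M.
Proof.
move=> la; rewrite -mulmxA lminor_mulr // -[X in _ * X]lminor_tr trmx_mul lminor_mulr //.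
rewrite [lminor k M^T]lminor_tr mulrA -expr2 lminor_lower //; congr (_ ^+ 2 * _).
by apply: eq_bigr => i _; rewrite mxE.
Qed.

Lemma lminor0 M : lminor 0 M = 1.
Proof.
rewrite /lminor (_ : trunc_mx 0 M = 1%:M) ?det1 //.
by apply/matrixP => i j; rewrite !mxE.
Qed.

End LeadingMinors.

Lemma map_trunc_mx (R S : comNzRingType) (f : {rmorphism R -> S}) n k (M : 'M[R]_n) :
  map_mx f (trunc_mx k M) = trunc_mx k (map_mx f M).
Proof. by apply/matrixP=> i j; rewrite !mxE; case: ifP => //; rewrite rmorph_nat. Qed.

Lemma map_lminor (R S : comNzRingType) (f : {rmorphism R -> S}) n k (M : 'M[R]_n) :
  f (lminor k M) = lminor k (map_mx f M).
Proof. by rewrite /lminor -map_trunc_mx det_map_mx. Qed.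

Section BlockMinors.
Variables (R : comNzRingType) (n : nat).

Lemma lminor_block k (p : R) (s : 'M[R]_n) :
  lminor k.+1 (block_mx p%:M 0 0 s : 'M_(1 + n)) = p * lminor k s.
Proof.
rewrite /lminor -[X in X * _](det_scalar1 p) -(det_ublock _ 0); congr (\det _).
apply/matrixP => i j; rewrite -(splitK i) -(splitK j).
case: (split i) => i'; case: (split j) => j' /=; rewrite [LHS]mxE ?block_mxEul ?block_mxEur ?block_mxEdl ?block_mxEdr.
- by rewrite !ord1 /= mxE.
- by rewrite !ord1 /= !mxE; case: ifP.
- by rewrite !ord1 /= !mxE; case: ifP.
- by rewrite [RHS]mxE /=  (inj_eq (@rshift_inj _ _)).
Qed.

Lemma upper_unitri_block (r : 'rV[R]_n) (u : 'M[R]_n) :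
  upper_unitri u -> upper_unitri (block_mx 1%:M r 0 u : 'M_(1 + n)).
Proof.
move=> uu i j; rewrite -(splitK i) -(splitK j).
case: (split i) => i'; case: (split j) => j' /=; rewrite ?block_mxEul ?block_mxEur ?block_mxEdl ?block_mxEdr.
- by rewrite !ord1 !mxE.
- by rewrite !ord1.
- by rewrite !ord1 mxE.
- by move=> /uu ->; rewrite (inj_eq (@rshift_inj _ _)).
Qed.
End BlockMinors.

(** By induction on the size, clearing the first row and column: the Schur complement [s]
    of the first entry [p] satisfies [D_(k+1)(a) = p D_k(s)], so its leading minors do not
    vanish either. *)
Lemma LDU_decomposition (F : fieldType) n (a : 'M[F]_n) :
    (forall k, (k <= n)%N -> lminor k a != 0) ->
  exists l t u, [/\ upper_unitri l^T, upper_unitri u, a = l *m diag_mx t *m u,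
    forall j, t 0 j != 0 & a^T = a -> l = u^T].
Proof.
elim: n a => [|n IH] a nz_a.
  exists 0, 0, 0; split=> [[]|[]||[]|_] //; last by rewrite trmx0.
  by rewrite [LHS]flatmx0 !mul0mx.
rewrite -[n.+1]/(1 + n)%N in a nz_a *.
pose p := a 0 0; pose r := ursubmx a; pose c := dlsubmx a.
pose s := drsubmx a - p^-1 *: (c *m r).
pose l1 : 'M_(1 + n) := block_mx 1%:M 0 (p^-1 *: c) 1%:M.
pose u1 : 'M_(1 + n) := block_mx 1%:M (p^-1 *: r) 0 1%:M.
have u1_uni : upper_unitri u1.
  by apply: upper_unitri_block => i j _; rewrite mxE.
have l1_uni : upper_unitri l1^T.
  rewrite tr_block_mx trmx0 !trmx1; apply: upper_unitri_block => i j _; rewrite mxE //.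
have aE (q : 'M_1) : q = ulsubmx a -> a = block_mx q r c (drsubmx a).
  by move=> ->; rewrite submxK.
have ulE : p%:M = ulsubmx a.
  apply/matrixP => i j; rewrite !ord1 !mxE /= /p; congr (a _ _); exact/val_inj.
have Dp k : (k <= n)%N -> p != 0 -> lminor k.+1 a = p * lminor k s.
  move=> _ nz_p; rewrite -lminor_block.
  have -> : a = l1 *m (block_mx p%:M 0 0 s *m u1).
    rewrite {1}(aE _ ulE) !mulmx_block !(mul0mx, mulmx0, mul1mx, mulmx1, addr0, add0r).
    rewrite -!scalemxAl -!scalemxAr mul_scalar_mx mul_mx_scalar.
    rewrite -!scalemxAr !scalerA -?mulrA !mulVf // mulr1 !scale1r /s.
    by rewrite addrC subrK.
  rewrite lminor_mulr; last exact: lower_unitri_tri.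
  rewrite -lminor_tr lminor_unitri // mul1r -[LHS]lminor_tr trmx_mul lminor_mulr.
    by rewrite lminor_tr lminor_unitri // mul1r lminor_tr.
  by apply: lower_unitri_tri; rewrite trmxK.
have nz_p : p != 0.
  have := nz_a 1 isT; suff -> : lminor 1 a = p * lminor 0 (0 : 'M[F]_n).
    by rewrite lminor0 mulr1.
  rewrite -lminor_block /lminor; congr (\det _); apply/matrixP => i j; rewrite [LHS]mxE [RHS]mxE.
  case: ifP => // /andP [i0 j0]; have -> : i = lshift n 0 by apply/val_inj; move: i0; rewrite ltnS leqn0 => /eqP.
  have -> : j = lshift n 0 by apply/val_inj; move: j0; rewrite ltnS leqn0 => /eqP.
  by rewrite block_mxEul mxE eqxx; congr (a _ _); exact/val_inj.
have [|l [t [u [lu uu sE nz_t symE]]]] := IH s.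
  by move=> k le_kn; have := nz_a k.+1 le_kn; rewrite Dp // mulf_eq0 negb_or => /andP [].
exists (block_mx 1%:M 0 (p^-1 *: c) l), (row_mx p%:M t), (block_mx 1%:M (p^-1 *: r) 0 u).
split.
- by rewrite tr_block_mx trmx0 trmx1; apply: upper_unitri_block.
- exact: upper_unitri_block.
- rewrite diag_mx_row !mulmx_block !(mul0mx, mulmx0, mul1mx, mulmx1, addr0, add0r).
  have -> : diag_mx (p%:M : 'rV_1) = p%:M by apply/matrixP => i j; rewrite !ord1 !mxE.
  rewrite mul_mx_scalar scalerA mulfV // scale1r -sE mul_scalar_mx scalerA mulfV // scale1r.
  rewrite {1}(aE _ ulE) -scalemxAr /s; congr block_mx.
  by rewrite addrC subrK.
- move=> j; rewrite -(splitK j); case: (split j) => j' /=.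
    by rewrite row_mxEl ord1 mxE.
  by rewrite row_mxEr.
- move=> aT; rewrite tr_block_mx trmx0 trmx1.
  have rT : r^T = c by rewrite /r trmx_ursub aT.
  rewrite linearZ /= rT symE // /s linearB linearZ /= trmx_drsub aT trmx_mul rT.
  by rewrite -rT trmxK.
Qed.

(** * Products of generic minors *)

Section Minors.
Variables (F : numFieldType) (n : nat).
Local Notation T := (tangent F n).
Local Notation S := (symAlg T).
Implicit Types (f : S) (Z a : 'M[F]_n) (g : 'M[F]_(n + n)) (t : 'rV[F]_n).

(** The generic symmetric matrix, whose entries generate the symmetric algebra. *)
Definition gen_mx : 'M[S]_n := \matrix_(k, l) sym_in (mx_tan (delta_mx k l)).

Lemma ev_gen Z k l : ev Z (gen_mx k l) = sym_part Z k l.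
Proof.
rewrite mxE ev_sym_in mx_tanK sym_part_adjoint.
rewrite (bigD1 k) //= [X in _ + X]big1 => [|i ne_ik]; last first.
  by rewrite big1 // => j _; rewrite mxE (negPf ne_ik) mul0r.
rewrite (bigD1 l) //= [X in _ + X + _]big1 => [|j ne_jl]; last first.
  by rewrite mxE (negPf ne_jl) andbF mul0r.
by rewrite mxE !eqxx mul1r !addr0.
Qed.

(** The highest weight vector of weight [2 lambda_k]. *)
Definition gen_minor (k : nat) : S := lminor k gen_mx.

Lemma ev_gen_minor k Z : ev Z (gen_minor k) = lminor k (sym_part Z).
Proof.
rewrite [LHS]map_lminor; congr (lminor k _); apply/matrixP => i j.
by rewrite [LHS]mxE [LHS]ev_gen.
Qed.

Lemma gen_minor_homog k : (k <= n)%N -> gen_minor k \is k.-homog.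
Proof.
move=> le_kn; rewrite /gen_minor /lminor /determinant; apply: rpred_sum => s _.
rewrite -signr_odd; set x := \prod_i _; suff xk : x \is k.-homog.
  by case: odd => /=; rewrite ?expr1 ?expr0 ?mulN1r ?mul1r ?rpredN.
have {1}-> : k = (\sum_(i < n) (i < k))%N.
  rewrite -(big_mkord xpredT (fun i => (i < k : nat))) (@big_cat_nat _ _ _ k) //=.
  rewrite big_nat (eq_bigr (fun=> 1%N)); last by move=> i /andP [_ ->].
  rewrite -big_nat sum_nat_const_nat muln1 subn0 big_nat big1 ?addn0 //.
  by move=> i /andP [le_ki _]; rewrite ltnNge le_ki.
apply: dhomog_bigprod => i _; rewrite mxE; have [lt_ik|le_ki] := ltnP i k => /=.
  case: ltnP => [_|le_kj].
    rewrite mxE /sym_in; apply: rpred_sum => j _; apply: rpredZ.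
    by rewrite dhomogX /= mdeg1.
  by rewrite [i == _]ltn_eqF ?dhomog0 // (leq_trans lt_ik).
by case: eqP => _; rewrite ?dhomog0 ?dhomog1.
Qed.

(** With exponent [e k] on the minor of size [k + 1], of weight [wt_mon e]. *)
Definition hwv_mon (e : 'I_n -> nat) : S := \prod_(k < n) gen_minor k.+1 ^+ e k.
Definition wt_mon (e : 'I_n -> nat) : weight n := \sum_(k < n) (fund_weight k *+ 2) *+ e k.

Lemma ev_hwv_mon e Z : ev Z (hwv_mon e) = \prod_(k < n) lminor k.+1 (sym_part Z) ^+ e k.
Proof.
by rewrite rmorph_prod /=; apply: eq_bigr => k _; rewrite rmorphXn /= ev_gen_minor.
Qed.

Lemma hwv_mon_homog e : hwv_mon e \is (\sum_(k < n) k.+1 * e k)%N.-homog.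
Proof. by apply: dhomog_bigprod => k _; apply: dhomogMn; apply: gen_minor_homog. Qed.

Lemma ev1_hwv_mon e : ev 1%:M (hwv_mon e) = 1.
Proof.
rewrite ev_hwv_mon sym_part_id ?trmx1 // big1 // => k _.
by rewrite lminor_unitri ?expr1n // => i j _; rewrite mxE.
Qed.

Lemma hwv_mon_neq0 e : hwv_mon e != 0.
Proof.
by apply/eqP => h0; have := ev1_hwv_mon e; rewrite h0 raddf0 => /eqP; rewrite eq_sym oner_eq0.
Qed.

Lemma weight_charD (mu nu : weight n) t : (forall j, t 0 j != 0) ->
  weight_char (mu + nu) t = weight_char mu t * weight_char nu t.
Proof.
move=> nz_t; rewrite /weight_char -big_split /=; apply: eq_bigr => j _.
by rewrite mxE expfzDr.
Qed.

Lemma weight_char0 t : weight_char 0 t = 1.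
Proof. by rewrite /weight_char big1 // => j _; rewrite mxE expr0z. Qed.

Lemma weight_charMn (mu : weight n) m t : (forall j, t 0 j != 0) ->
  weight_char (mu *+ m) t = weight_char mu t ^+ m.
Proof.
move=> nz_t; elim: m => [|m IH]; first by rewrite weight_char0.
by rewrite mulrS weight_charD // IH exprS.
Qed.

Lemma weight_char_fund (k : 'I_n) t :
  weight_char (fund_weight k) t = \prod_(j < n | (j < k.+1)%N) t 0 j.
Proof.
rewrite [RHS]big_mkcond; apply: eq_bigr => j _; rewrite mxE ltnS.
by case: leqP.
Qed.

(** The square is the factor by which [a] multiplies a minor in [lminor_congr]. *)
Lemma weight_char_mon e t : (forall j, t 0 j != 0) ->
  weight_char (wt_mon e) t = \prod_(k < n) (\prod_(j < n | (j < k.+1)%N) t 0 j) ^+ (2 * e k).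
Proof.
move=> nz_t; rewrite /wt_mon.
rewrite (big_morph (fun mu : weight n => weight_char mu t) (id1 := 1) (op1 := *%R)); first last.
- exact: weight_char0.
- by move=> mu nu; apply: weight_charD.
apply: eq_bigr => k _.
by rewrite !weight_charMn // -exprM weight_char_fund.
Qed.

Definition levi_mx a : 'M[F]_(n + n) := block_mx a 0 0 (invmx a)^T.

Lemma ul_levi_mx a : ulsubmx (levi_mx a) = a.
Proof. exact: block_mxKul. Qed.

Lemma levi_mxP a : a \in unitmx -> Levi (levi_mx a).
Proof.
move=> aU; split; last by rewrite block_mxKdl.
split; last by rewrite block_mxKur.
rewrite /Sp /levi_mx /sympJ tr_block_mx !mulmx_block !trmx0 trmxK.
rewrite !(mulmxN, mulNmx, mul0mx, mulmx0, mul1mx, mulmx1, oppr0) !(add0r, addr0).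
by rewrite !mul0mx -trmx_mul mulNmx !mulVmx // trmx1.
Qed.

Lemma torus_levi_mx t : (forall j, t 0 j != 0) ->
  diag_mx t \in unitmx /\ torus t = levi_mx (diag_mx t).
Proof.
move=> nz_t; have tV : diag_mx (map_mx GRing.inv t) *m diag_mx t = 1%:M.
  apply/matrixP => i j; rewrite mul_diag_mx !mxE; have [->|_] := eqVneq i j; last by rewrite mulr0.
  by rewrite mulVf.
have [_ tU] := mulmx1_unit tV; split=> //.
rewrite /torus /levi_mx; congr block_mx; rewrite -[LHS]tr_diag_mx; congr _^T.
by rewrite -[RHS]mul1mx -tV mulmxK.
Qed.

Lemma upper_unitri_unit a : upper_unitri a -> a \in unitmx.
Proof.
move=> ua; rewrite unitmxE -det_tr det_trig.
  by rewrite big1 ?unitr1 // => i _; rewrite mxE ua // eqxx.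
by apply/is_trig_mxP; apply: lower_unitri_tri; rewrite trmxK.
Qed.

Lemma levi_unipP a : upper_unitri a -> Levi_unip (levi_mx a).
Proof.
move=> ua; split; first exact/levi_mxP/upper_unitri_unit.
by move=> i j le_ji; rewrite ul_levi_mx ua.
Qed.

Lemma hwvP mu f : highest_weight_vector (@sym_act F n) mu f <->
  [/\ f != 0, forall u Z, upper_unitri u -> ev (u^T *m Z *m u) f = ev Z f
    & forall t Z, (forall j, t 0 j != 0) ->
        ev (diag_mx t *m Z *m diag_mx t) f = weight_char mu t * ev Z f].
Proof.
split=> [[nz_f Uf Tf]|[nz_f Uf Tf]]; split=> //.
- move=> u Z uu; have := Uf _ (levi_unipP uu).
  move=> /(congr1 (ev Z)); rewrite ev_act ?ul_levi_mx //.
  by have [] := levi_mxP (upper_unitri_unit uu).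
- move=> t Z nz_t; have [tU tE] := torus_levi_mx nz_t.
  have := Tf t nz_t => /(congr1 (ev Z)); rewrite tE ev_act ?ul_levi_mx ?tr_diag_mx ?evZ //.
  by have [] := levi_mxP tU.
- move=> g [[Pg _] ug]; apply/eqP; rewrite -subr_eq0; apply/eqP; apply: ev_eq0 => Z _.
  by rewrite rmorphB /= ev_act // Uf ?subrr.
- move=> t nz_t; have [tU tE] := torus_levi_mx nz_t.
  apply/eqP; rewrite -subr_eq0; apply/eqP; apply: ev_eq0 => Z _.
  rewrite rmorphB /= tE ev_act; last by have [] := levi_mxP tU.
  by rewrite ul_levi_mx tr_diag_mx Tf // evZ subrr.
Qed.

Lemma sym_part_congr a Z : sym_part (a^T *m Z *m a) = a^T *m sym_part Z *m a.
Proof.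
rewrite /sym_part -scalemxAr -scalemxAl !trmx_mul trmxK mulmxDr mulmxDl.
by rewrite mulmxA.
Qed.

Lemma hwv_mon_hwv e : highest_weight_vector (@sym_act F n) (wt_mon e) (hwv_mon e).
Proof.
apply/hwvP; split; first exact: hwv_mon_neq0.
- move=> u Z uu; rewrite !ev_hwv_mon; apply: eq_bigr => k _.
  rewrite sym_part_congr lminor_congr; last by apply: lower_unitri_tri; rewrite trmxK.
  by rewrite big1 ?expr1n ?mul1r // => i _; rewrite uu // eqxx.
- move=> t Z nz_t; rewrite weight_char_mon // !ev_hwv_mon -big_split /=.
  apply: eq_bigr => k _; rewrite -{1}[diag_mx t]tr_diag_mx sym_part_congr lminor_congr.
    rewrite exprMn -exprM; congr (_ ^+ _ * _).
    by apply: eq_bigr => j _; rewrite mxE eqxx.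
  by move=> i j lt_ij; rewrite tr_diag_mx mxE [i == j]ltn_eqF.
Qed.

End Minors.

(** * Classification of highest weight vectors *)

Section SwapMatrix.
Variables (R : comNzRingType) (n : nat).

(** The permutation matrix that exchanges the indices [k] and [k + 1], where row and
    column [k] are zero when [k + 1] is out of range.  It is symmetric and its only
    vanishing leading minor is that of size [k + 1]. *)
Definition swap_mx (k : 'I_n) : 'M[R]_n := \matrix_(i, j)
  ((i == k) && (j == k.+1 :> nat) || (i == k.+1 :> nat) && (j == k)
   || [&& i != k, i != k.+1 :> nat & i == j])%:R.

Lemma swap_mx_tr k : (swap_mx k)^T = swap_mx k.
Proof.
apply/matrixP => i j; rewrite !mxE; congr (nat_of_bool _)%:R.
have [->|ne_ij] := eqVneq i j; first by rewrite [X in X || _]orbC.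
by rewrite !andbF !orbF orbC [X in X || _]andbC [X in _ || X]andbC.
Qed.

Lemma lminor_swap_mx (k : 'I_n) (m : nat) : (m <= n)%N ->
  lminor m (swap_mx k) = (if m == k.+1 then 0 else if (m <= k)%N then 1 else - 1).
Proof.
move=> le_mn; case: eqP => [->|/eqP ne_mk].
  rewrite /lminor (expand_det_row _ k) big1 // => j _.
  rewrite [trunc_mx _ _ _ _]mxE ltnSn /= !mxE eqxx /= !orbF.
  case: ltnP => [lt_jk|le_kj].
    rewrite [j == k.+1 :> nat]ltn_eqF // [_ == _ :> nat]ltn_eqF // mul0r //.
  by rewrite [k == j]ltn_eqF ?mul0r.
case: leqP => [le_mk|lt_km].
  rewrite /lminor (_ : trunc_mx m _ = 1%:M) ?det1 //.
  apply/matrixP => i j; rewrite !mxE; case: ifP => // /andP [lt_im lt_jm].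
  rewrite [i == k]ltn_eqF ?(leq_trans lt_im) // [i == k.+1 :> nat]ltn_eqF //.
  exact: leq_trans lt_im (leqW le_mk).
have lt_k1m : (k.+1 < m)%N by rewrite ltn_neqAle eq_sym ne_mk.
pose k' := Ordinal (leq_trans lt_k1m le_mn).
rewrite /lminor (_ : trunc_mx m _ = perm_mx (tperm k k')).
  by rewrite det_perm odd_tperm -val_eqE /= [_ == k.+1]ltn_eqF.
have ek' (i : 'I_n) : (i == k.+1 :> nat) = (i == k') by rewrite -val_eqE.
apply/matrixP => i j; rewrite !mxE !ek'; case: tpermP => [->|->|/eqP ne_ik /eqP ne_ik'].
- rewrite lt_km eqxx /= [k == k']ltn_eqF //= orbF [j == k']eq_sym.
  case: ltnP => [_|le_mj]; first by rewrite ?orbF.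
  have lt_j := leq_trans lt_k1m le_mj.
  by rewrite [k == j]ltn_eqF ?(ltnW lt_j) // [k' == j]ltn_eqF.
- rewrite lt_k1m eqxx /= [k' == k]gtn_eqF //= orbF [j == k]eq_sym.
  case: ltnP => [_|le_mj]; first by rewrite ?orbF.
  have lt_j := leq_trans lt_k1m le_mj.
  by rewrite [k == j]ltn_eqF ?(ltnW lt_j) // [k' == j]ltn_eqF.
- by rewrite (negPf ne_ik) (negPf ne_ik') /=; case: ifP.
Qed.
End SwapMatrix.

Section Classification.
Variables (F : numClosedFieldType) (n : nat).
Local Notation T := (tangent F n).
Local Notation S := (symAlg T).
Implicit Types (f : S) (Y Z a : 'M[F]_n) (t : 'rV[F]_n) (mu : weight n).

Definition generic Y := forall k, (k <= n)%N -> lminor k Y != 0.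

(** The product of all the minors is a nonzero polynomial, and [f] times it vanishes on all
    symmetric matrices. *)
Lemma ev_generic_eq0 f : (forall Y, Y^T = Y -> generic Y -> ev Y f = 0) -> f = 0.
Proof.
move=> f0; suff: f * hwv_mon F (fun _ : 'I_n => 1%N) = 0.
  by move/eqP; rewrite mulf_eq0 (negPf (hwv_mon_neq0 _ _)) orbF => /eqP.
apply: ev_eq0 => Y YT; rewrite rmorphM /=.
have [->|] := eqVneq (ev Y (hwv_mon F (fun _ : 'I_n => 1%N))) 0; first exact: mulr0.
rewrite ev_hwv_mon sym_part_id // => /prodf_neq0 nzY; rewrite f0 ?mul0r //.
case=> [|k] lt_kn; first by rewrite lminor0 oner_neq0.
by have := nzY (Ordinal lt_kn) isT; rewrite expr1.
Qed.

(** The square roots of the entries of [D] in [Y = u^T D u] are taken in the algebraically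
    closed field. *)
Lemma generic_symmetric Y : Y^T = Y -> generic Y ->
  exists t u, [/\ forall j, t 0 j != 0, upper_unitri u,
    Y = u^T *m (diag_mx t *m 1%:M *m diag_mx t) *m u
    & forall k, lminor k Y = \prod_(j < n | (j < k)%N) t 0 j ^+ 2].
Proof.
move=> YT genY; have [l [d [u [_ uu YE nz_d lE]]]] := LDU_decomposition genY.
have {lE} lE := lE YT; pose t := map_mx sqrtC d.
have dE : diag_mx d = diag_mx t *m 1%:M *m diag_mx t.
  rewrite mulmx1 mulmx_diag; congr diag_mx; apply/rowP => j.
  by rewrite !mxE -expr2 sqrtCK.
have YE' : Y = u^T *m (diag_mx t *m 1%:M *m diag_mx t) *m u by rewrite YE lE dE.
exists t, u; split=> // [j|k]; first by rewrite mxE sqrtC_eq0.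
rewrite YE' lminor_congr; last by apply: lower_unitri_tri; rewrite trmxK.
rewrite big1 ?expr1n ?mul1r; last by move=> i _; rewrite uu // eqxx.
rewrite -{1}[diag_mx t]tr_diag_mx lminor_congr; last first.
  by move=> i j lt_ij; rewrite tr_diag_mx mxE [i == j]ltn_eqF.
rewrite lminor_unitri ?mulr1 => [|i j _]; last by rewrite mxE.
by rewrite -prodrXl; apply: eq_bigr => j _; rewrite !mxE eqxx.
Qed.

Lemma weight_charZ mu (z : int) t : (forall j, t 0 j != 0) ->
  weight_char (mu *~ z) t = weight_char mu t ^ z.
Proof.
move=> nz_t; case: z => m; first exact: weight_charMn.
rewrite NegzE mulrNz -exprnN -weight_charMn //.
have := weight_charD (- (mu *+ m.+1)) (mu *+ m.+1) nz_t.
rewrite addNr weight_char0; set B := weight_char (mu *+ m.+1) t => E.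
have nzB : B != 0.
  by apply/eqP => B0; move: E; rewrite B0 mulr0 => /eqP; rewrite oner_eq0.
by rewrite -[LHS](mulfK nzB) -E div1r.
Qed.

(** The coefficients are the successive differences of the coordinates of [mu]. *)
Lemma weight_fund_sum mu : exists z : 'I_n -> int, mu = \sum_(k < n) fund_weight k *~ z k.
Proof.
pose m k := if insub k is Some i then mu 0 i else 0.
exists (fun k => m k - m k.+1); apply/rowP => j; rewrite summxE.
transitivity (\sum_(j <= k < n) (m k - m k.+1)).
  rewrite -[RHS]opprK -sumrN; under eq_bigr do rewrite opprB.
  rewrite telescope_sumr; last exact: ltnW.
  have -> : m n = 0 by rewrite /m insubF ?ltnn.
  by rewrite sub0r opprK /m valK.
rewrite (big_nat_widenl _ 0) // big_mkord big_mkcond /=; apply: eq_bigr => k _.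
have -> (z : int) : (fund_weight k *~ z) 0 j = fund_weight k 0 j *~ z.
  case: z => p; first exact: mulmxnE.
  by rewrite NegzE !mulrNz mxE; congr (- _); exact: mulmxnE.
by rewrite mxE; case: leqP => _; rewrite ?mul0rz // intz.
Qed.

Lemma ev_hwv_generic mu f t u : highest_weight_vector (@sym_act F n) mu f ->
    (forall j, t 0 j != 0) -> upper_unitri u ->
  ev (u^T *m (diag_mx t *m 1%:M *m diag_mx t) *m u) f = weight_char mu t * ev 1%:M f.
Proof. by move=> /hwvP [_ Uf Tf] nz_t uu; rewrite Uf // Tf. Qed.

(** On matrices with nonzero minors, [f] is a multiple of its value at the identity. *)
Lemma ev1_hwv mu f : highest_weight_vector (@sym_act F n) mu f -> ev 1%:M f != 0.
Proof.
move=> hf; have [nz_f _ _] := hf; apply: contra_neq nz_f => f1.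
apply: ev_generic_eq0 => Y YT genY.
have [t [u [nz_t uu -> _]]] := generic_symmetric YT genY.
by rewrite (ev_hwv_generic hf) // f1 mulr0.
Qed.

(** Changing the sign of one basis vector fixes the identity matrix, and multiplies the
    value of [f] there by the sign [(-1) ^ mu_j]. *)
Lemma hwv_weight_even mu f j : highest_weight_vector (@sym_act F n) mu f ->
  exists z, mu 0 j = z *+ 2.
Proof.
move=> hf; have [_ _ Tf] := proj1 (hwvP _ _) hf; have nz := ev1_hwv hf.
(* The sign change of the basis vector [j]. *)
pose t : 'rV[F]_n := \row_i (if i == j then -1 else 1).
have tt : diag_mx t *m 1%:M *m diag_mx t = 1%:M.
  rewrite mulmx1 mulmx_diag -diag_const_mx; congr diag_mx; apply/rowP => i.
  by rewrite !mxE; case: eqP; rewrite ?mulrNN mulr1.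
have nz_t i : t 0 i != 0 by rewrite mxE; case: ifP; rewrite ?oppr_eq0 oner_eq0.
have : weight_char mu t = 1 by apply: (mulIf nz); rewrite -Tf // tt mul1r.
rewrite /weight_char (bigD1 j) //= big1 ?mulr1 => [|i ne_ij]; last first.
  by rewrite mxE (negPf ne_ij) exp1rz.
rewrite mxE eqxx expN1r -signr_odd.
have [odd_mu /eqP|even_mu _] := boolP (odd _).
  by rewrite expr1 eq_sym -subr_eq0 opprK -(natrD _ 1 1) pnatr_eq0.
exists (divz (mu 0 j) (Posz 2)); rewrite -[RHS]mulr_natr natz divzK // dvdzE dvdn2.
exact: even_mu.
Qed.

(** Comparing values on [u^T (t 1 t) u] gives [f = c prod_k D_(k+1) ^ z_k] with integers
    [z_k], where [mu = sum_k 2 z_k lambda_(k+1)].  Clearing denominators yields a polynomial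
    identity, and a negative [z_k] is impossible: at [swap_mx k] only [D_(k+1)] vanishes. *)
Lemma hwv_classification mu f : highest_weight_vector (@sym_act F n) mu f ->
  exists e : 'I_n -> nat, mu = wt_mon e /\ exists2 c, c != 0 & f = c *: hwv_mon F e.
Proof.
move=> hf; have nz := ev1_hwv hf.
have [nu muE] : exists nu : weight n, mu = nu *+ 2.
  have [h hE] : exists h : 'I_n -> int, forall j, mu 0 j = h j *+ 2.
    exact: (fin_all_exists (fun j => hwv_weight_even j hf)).
  by exists (\row_j h j); apply/rowP => j; rewrite mulmxnE mxE hE.
have [z nuE] := weight_fund_sum nu.
have muz : mu = \sum_(k < n) (fund_weight k *+ 2) *~ z k.
  rewrite muE nuE -sumrMnl; apply: eq_bigr => k _.
  by rewrite [LHS]pmulrn [fund_weight k *+ 2]pmulrn mulrzAC.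
(* The positive and negative parts of the exponents [z k]. *)
pose pos k : nat := if 0 <= z k then `|z k|%N else 0%N.
pose neg k : nat := if 0 <= z k then 0%N else `|z k|%N.
have zE k : z k = (pos k)%:Z - (neg k)%:Z.
  rewrite /pos /neg; have [ge0|lt0] := leP 0 (z k); first by rewrite subr0 gez0_abs.
  by rewrite sub0r ltz0_abs // opprK.
pose c := ev 1%:M f.
have fE : f * hwv_mon F neg = c *: hwv_mon F pos.
  apply/eqP; rewrite -subr_eq0; apply/eqP; apply: ev_generic_eq0 => Y YT genY.
  rewrite rmorphB rmorphM /= evZ !ev_hwv_mon sym_part_id //; apply/eqP; rewrite subr_eq0; apply/eqP.
  have [t [u [nz_t uu YE minE]]] := generic_symmetric YT genY.
  rewrite {1}YE (ev_hwv_generic hf) // -/c [_ * c]mulrC -mulrA; congr (_ * _).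
  rewrite muz (big_morph (fun mu : weight n => weight_char mu t) (id1 := 1) (op1 := *%R)); first last.
  - exact: weight_char0.
  - by move=> mu1 mu2; apply: weight_charD.
  rewrite -big_split /=; apply: eq_bigr => k _.
  rewrite weight_charZ // weight_charMn // weight_char_fund -prodrXl -minE.
  have nzk : lminor k.+1 Y != 0 by apply: genY.
  by rewrite zE expfzDr // -mulrA -exprnN mulVf ?mulr1 ?expf_neq0.
have neg0 k : neg k = 0%N.
  apply/eqP/negPn/negP => nk; have pk : pos k = 0%N.
    by move: nk; rewrite /neg /pos; case: ifP.
  have := congr1 (ev (swap_mx F k)) fE; rewrite rmorphM /= evZ !ev_hwv_mon.
  rewrite sym_part_id ?swap_mx_tr // (bigD1 k) //= lminor_swap_mx // eqxx expr0n (negPf nk).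
  rewrite mul0r mulr0 => /esym/eqP; rewrite mulf_eq0 (negPf nz) /=; apply/negP.
  apply/prodf_neq0 => l _; have [->|ne_lk] := eqVneq l k; first by rewrite pk oner_neq0.
  rewrite expf_neq0 // lminor_swap_mx // eqSS val_eqE (negPf ne_lk).
  by case: ifP; rewrite ?oppr_eq0 oner_eq0.
exists pos; split.
  by rewrite muz; apply: eq_bigr => k _; rewrite zE neg0 subr0.
exists c => //; rewrite -fE [hwv_mon _ neg]big1 ?mulr1 // => k _.
by rewrite neg0.
Qed.

End Classification.

(** * Existence of highest weight vectors *)

Section Supports.
Variables (N : nat) (R : comNzRingType).
Implicit Types (p q : {mpoly R[N]}) (P : 'X_{1..N} -> Prop).

Definition supp_in P p := forall m, m \in msupp p -> P m.

Lemma supp_inZ P c p : supp_in P p -> supp_in P (c *: p).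
Proof. by move=> Pp m /msuppZ_le /Pp. Qed.

Lemma supp_inD P p q : supp_in P p -> supp_in P q -> supp_in P (p + q).
Proof. by move=> Pp Pq m /msuppD_le; rewrite mem_cat => /orP [/Pp|/Pq]. Qed.

Lemma supp_inB P p q : supp_in P p -> supp_in P q -> supp_in P (p - q).
Proof. by move=> Pp Pq m /msuppB_le; rewrite mem_cat => /orP [/Pp|/Pq]. Qed.

Lemma supp_in_sum P (I : Type) (r : seq I) (Q : pred I) (f : I -> {mpoly R[N]}) :
  (forall i, Q i -> supp_in P (f i)) -> supp_in P (\sum_(i <- r | Q i) f i).
Proof.
move=> Pf; apply: (big_ind (supp_in P)) => // [m|p q Pp Pq]; last exact: supp_inD.
by rewrite msupp0.
Qed.

Lemma supp_inM (P1 P2 P : 'X_{1..N} -> Prop) p q :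
    (forall m1 m2, P1 m1 -> P2 m2 -> P (m1 + m2)%MM) ->
  supp_in P1 p -> supp_in P2 q -> supp_in P (p * q).
Proof.
move=> PM Pp Pq m /msuppM_le /allpairsP [[m1 m2] /= [m1p m2q ->]].
by apply: PM; [apply: Pp | apply: Pq].
Qed.

Lemma supp_inX P m : P m -> supp_in P 'X_[m].
Proof. by move=> Pm m'; rewrite msuppX inE => /eqP ->. Qed.

Lemma supp_in_linear P Q (phi : {linear {mpoly R[N]} -> {mpoly R[N]}}) p :
  (forall m, P m -> supp_in Q (phi 'X_[m])) -> supp_in P p -> supp_in Q (phi p).
Proof.
move=> PQ Pp; rewrite [p]mpolyE linear_sum big_seq; apply: supp_in_sum => m /Pp Pm.
by rewrite linearZ; apply: supp_inZ; apply: PQ.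
Qed.

End Supports.

Section Heights.
Variables (F : numFieldType) (n : nat).
Implicit Types (m : 'X_{1..n * n}) (p q : {mpoly F[n * n]}) (t : 'rV[F]_n).

(** The pairing of the weight of the variable [Z_kl] with a regular dominant coweight. *)
Definition var_ht (v : 'I_(n * n)) : nat :=
  mxvec (\matrix_(k < n, l < n) ((n - k) + (n - l))%N) 0 v.
Definition ht m : nat := \sum_v m v * var_ht v.

Definition high d p := supp_in (fun m => d <= ht m)%N p.
(** [p] and [q] agree in height [d], and all the other terms are higher. *)
Definition near_top d p q := high d q /\ high d.+1 (p - q).

Lemma htD m1 m2 : ht (m1 + m2)%MM = (ht m1 + ht m2)%N.
Proof. by rewrite /ht -big_split; apply: eq_bigr => v _; rewrite mnmDE mulnDl. Qed.

Lemma ht1 v : ht U_(v)%MM = var_ht v.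
Proof.
rewrite /ht (bigD1 v) //= big1 ?addn0 => [|w ne_wv]; first by rewrite mnm1E eqxx mul1n.
by rewrite mnm1E eq_sym (negPf ne_wv).
Qed.

Lemma ht_le_deg m : (ht m <= mdeg m * (n + n))%N.
Proof.
rewrite mdegE big_distrl /=; apply: leq_sum => v _; rewrite leq_mul2l; apply/orP; right.
by case/mxvec_indexP: v => k l; rewrite /var_ht mxvecE mxE leq_add // leq_subr.
Qed.

Lemma highM d d' p q : high d p -> high d' q -> high (d + d') (p * q).
Proof. by apply: supp_inM => m1 m2 h1 h2; rewrite htD leq_add. Qed.

Lemma highW d d' p : (d <= d')%N -> high d' p -> high d p.
Proof. by move=> le_dd hp m /hp; apply: leq_trans. Qed.

Lemma near_topM d d' p q p' q' :
  near_top d p q -> near_top d' p' q' -> near_top (d + d') (p * p') (q * q').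
Proof.
move=> [hq hpq] [hq' hpq']; split; first exact: highM.
have -> : p * p' - q * q' = (p - q) * q' + q * (p' - q') + (p - q) * (p' - q').
  by ring.
do 2?apply: supp_inD; rewrite -/(high _ _).
- by rewrite -addSn; apply: highM.
- by rewrite -addnS; apply: highM.
- by apply: highW (highM hpq hpq'); rewrite addSn addnS ltnW.
Qed.

(** An upper unitriangular [u] maps [Z_pq] to itself plus multiples of [Z_kl] with [k <= p] and
    [l <= q], at least one inequality being strict, which have larger height. *)
Lemma near_top_unitri u m : upper_unitri u ->
  near_top (ht m) (msubst (conj_mx u) 'X_[m]) ('X_[m] : {mpoly F[n * n]}).
Proof.
move=> uu; rewrite mpolyXE_id rmorph_prod /=.
apply: (big_rec3 (fun d p q => near_top d p q)) => [|v d p q _ IH].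
  split; first by rewrite -mpolyX0; apply: supp_inX.
  by rewrite subrr => m'; rewrite msupp0.
apply: near_topM IH; rewrite rmorphXn /=; elim: (m v) => [|k IHk].
  split; first by rewrite expr0 -mpolyX0; apply: supp_inX.
  by rewrite subrr => m'; rewrite msupp0.
rewrite !exprS mulSn; apply: near_topM IHk; split.
  by apply: supp_inX; rewrite ht1.
rewrite msubstX (bigD1 v) //=; case/mxvec_indexP: v => p' q'.
rewrite conj_mxE !uu // !eqxx mulr1 scale1r addrAC subrr add0r.
apply: supp_in_sum => w; case/mxvec_indexP: w => k' l' ne_w.
have [->|nz_c] := eqVneq (conj_mx u (mxvec_index k' l') (mxvec_index p' q')) 0.
  by rewrite scale0r => m'; rewrite msupp0.
apply: supp_inZ; apply: supp_inX; rewrite ht1 /var_ht !mxvecE !mxE.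
move: nz_c; rewrite conj_mxE mulf_eq0 negb_or => /andP [nzk nzl].
have le_k : (k' <= p')%N by rewrite leqNgt; apply: contra nzk => lt; rewrite (uu _ _ (ltnW lt)) [k' == p']gtn_eqF.
have le_l : (l' <= q')%N by rewrite leqNgt; apply: contra nzl => lt; rewrite (uu _ _ (ltnW lt)) [l' == q']gtn_eqF.
have ne_kl : (k' != p') || (l' != q').
  by rewrite -negb_and; apply: contra ne_w => /andP [/eqP -> /eqP ->].
have := ltn_ord p'; have := ltn_ord q'; move: ne_kl; rewrite -!val_eqE /=.
lia.
Qed.

Lemma high_unitri u d p : upper_unitri u -> high d p ->
  high d.+1 (msubst (conj_mx u) p - p).
Proof.
move=> uu hp; have -> : msubst (conj_mx u) p - p =
    \sum_(m <- msupp p) p@_m *: (msubst (conj_mx u) 'X_[m] - 'X_[m]).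
  under eq_bigr do rewrite scalerBr -linearZ.
  by rewrite sumrB -linear_sum -!mpolyE.
rewrite big_seq; apply: supp_in_sum => m /hp le_d; apply: supp_inZ.
by apply: highW (proj2 (near_top_unitri m uu)); rewrite ltnS.
Qed.

Lemma low_msubst r (L : 'M[F]_(n * n)) p :
  supp_in (fun m => mdeg m <= r)%N p -> supp_in (fun m => mdeg m <= r)%N (msubst L p).
Proof.
apply: supp_in_linear => m le_r m' m'L.
have homX : ('X_[m] : {mpoly F[n * n]}) \is (mdeg m).-homog by rewrite dhomogX.
by rewrite (dhomog_mf (dhomog_msubst L homX) m'L).
Qed.

(** The variable [Z_kl] has weight [e_k + e_l]. *)
Definition mon_wt m : weight n :=
  \sum_v mxvec (\matrix_(k < n, l < n) (delta_mx 0 k + delta_mx 0 l : weight n)) 0 v *+ m v.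

Lemma weight_char_delta t k : weight_char (delta_mx 0 k) t = t 0 k.
Proof.
rewrite /weight_char (bigD1 k) //= big1 ?mulr1 => [|j ne_jk]; first by rewrite mxE !eqxx expr1z.
by rewrite mxE (negPf ne_jk) andbF expr0z.
Qed.

Lemma msubst_torus t m : (forall j, t 0 j != 0) ->
  msubst (conj_mx (diag_mx t)) 'X_[m] = weight_char (mon_wt m) t *: ('X_[m] : {mpoly F[n * n]}).
Proof.
move=> nz_t; rewrite /mon_wt.
rewrite (big_morph (fun mu : weight n => weight_char mu t) (id1 := 1) (op1 := *%R)); first last.
- exact: weight_char0.
- by move=> mu nu; apply: weight_charD.
rewrite {1 2}mpolyXE_id rmorph_prod -scaler_prod /=; apply: eq_bigr => v _.
rewrite rmorphXn weight_charMn // -exprZn; congr (_ ^+ _).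
rewrite /= msubstX (bigD1 v) //= [X in _ + X]big1 => [|w].
  case/mxvec_indexP: v => p q; rewrite addr0 conj_mxE mxvecE [in RHS]mxE weight_charD //.
  by rewrite !weight_char_delta !mxE !eqxx.
case/mxvec_indexP: v => p q; case/mxvec_indexP: w => k l ne; rewrite conj_mxE !mxE.
have [kp|] := eqVneq k p; last by rewrite mul0r scale0r.
have [lq|] := eqVneq l q; last by rewrite mulr0 scale0r.
by rewrite kp lq eqxx in ne.
Qed.

Lemma mcoeff_torus t p m : (forall j, t 0 j != 0) ->
  (msubst (conj_mx (diag_mx t)) p)@_m = weight_char (mon_wt m) t * p@_m.
Proof.
move=> nz_t; elim/mpolyind: p => [|c m' p _ _ IH]; first by rewrite linear0 !mcoeff0 mulr0.
rewrite linearD linearZ /= !mcoeffD mulrDr IH msubst_torus // !mcoeffZ mcoeffX.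
by congr (_ + _); case: eqP => [->|_]; rewrite ?mulr0 // !mulr1 mulrC.
Qed.

End Heights.

Section Existence.
Variables (F : numFieldType) (n : nat).
Local Notation S := (symAlg (tangent F n)).
Local Notation act := (@sym_act F n).
Implicit Types (f : S) (g : 'M[F]_(n + n)) (t : 'rV[F]_n).

Lemma Levi_unip_Pn g : Levi_unip g -> Pn g /\ upper_unitri (ulsubmx g).
Proof. by case=> [[Pg _] ug]. Qed.

Lemma torus_Levi t : (forall j, t 0 j != 0) -> Levi (torus t) /\ ulsubmx (torus t) = diag_mx t.
Proof.
move=> nz_t; have [tU tE] := torus_levi_mx nz_t.
by split; [rewrite tE; apply: levi_mxP | apply: block_mxKul].
Qed.

(** Among the nonzero elements of [W] of bounded degree choose one, [f], whose lowest height
    [d] is as large as possible and, subject to that, with fewest monomials.  If [u] is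
    unipotent, [u f - f] has lowest height above [d], so it is zero; if [t] is in the torus
    and [chi] is the weight of a monomial [m0] of [f], then [t f - chi(t) f] has fewer
    monomials, so it is zero too.  The choice is an induction on [r * (n + n) - d], then on
    the size of the support. *)
Lemma hwv_exists (W : S -> Prop) f0 : submodule (@Levi F n) act W -> W f0 -> f0 != 0 ->
  exists mu h, W h /\ highest_weight_vector act mu h.
Proof.
case=> [[W0 Wlin] Wact] Wf0 nz_f0.
have WB c f f' : W f -> W f' -> W (f' - c *: f).
  by move=> Wf Wf'; rewrite addrC -scaleNr; apply: Wlin.
pose low d (p : {mpoly F[n * n]}) := supp_in (fun m => mdeg m <= d)%N p.
pose r := msize (iota_mx f0).
have low0 : low r (iota_mx f0) by move=> m /msize_mdeg_lt /ltnW.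
(* A height [d] above [r * (n + n)] is impossible in degree at most [r]. *)
suff main k : forall d s f, (r * (n + n) < d + k)%N -> (size (msupp (iota_mx f)) <= s)%N ->
    W f -> f != 0 -> high d (iota_mx f) -> low r (iota_mx f) ->
    exists mu h, W h /\ highest_weight_vector act mu h.
  by apply: (main (r * (n + n)).+1 0%N _ f0 _ (leqnn _)).
elim: k => [|k IHk] d s f.
  rewrite addn0 => lt_d _ _ nz_f hf lf.
  have : iota_mx f != 0 by apply: contra nz_f => /eqP f0'; apply/eqP/iota_mx_inj; rewrite f0' linear0.
  rewrite -msupp_eq0; case E: (msupp _) => [//|m ms] _.
  have mf : m \in msupp (iota_mx f) by rewrite E mem_head.
  have := leq_ltn_trans (leq_mul (lf _ mf) (leqnn (n + n))) lt_d.
  by rewrite ltnNge (leq_trans (hf _ mf) (ht_le_deg _)).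
elim: s f => [|s IHs] f lt_d le_s Wf nz_f hf lf.
  move: le_s; rewrite leqn0 size_eq0 msupp_eq0 => /eqP f0'.
  by case/eqP: nz_f; apply: iota_mx_inj; rewrite f0' linear0.
have [[g [Ug nfix]]|Ufix] := boolp.lem (exists g, Levi_unip g /\ act g f <> f).
  have [Pg uu] := Levi_unip_Pn Ug.
  apply: (IHk d.+1 _ (act g f - f) _ (leqnn _)); first by rewrite addSnnS.
  - by rewrite -[f in X in _ - X]scale1r; apply: WB => //; apply: Wact => //; case: Ug.
  - by rewrite subr_eq0; apply/eqP.
  - by rewrite linearB /= iota_act //; apply: high_unitri.
  - by rewrite linearB /= iota_act //; apply: supp_inB => //; apply: low_msubst.
have [m0 m0f] : exists m, m \in msupp (iota_mx f).
  case E: (msupp (iota_mx f)) => [|m ms]; last by exists m; rewrite mem_head.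
  by case/eqP: nz_f; apply: iota_mx_inj; rewrite linear0; apply: msuppnil0.
pose mu := mon_wt m0.
have [[t [nz_t nfix]]|Tfix] := boolp.lem (exists t, (forall j, t 0 j != 0) /\
    act (torus t) f <> weight_char mu t *: f).
  have [Lt ulE] := torus_Levi nz_t; have [Pt _] := Lt.
  have iE : iota_mx (act (torus t) f - weight_char mu t *: f) =
      msubst (conj_mx (diag_mx t)) (iota_mx f) - weight_char mu t *: iota_mx f.
    by rewrite linearB linearZ /= (iota_act _ Pt) ulE.
  have supE m : m \in msupp (iota_mx (act (torus t) f - weight_char mu t *: f)) ->
      (m \in msupp (iota_mx f)) && (m != m0).
    rewrite iE !mcoeff_msupp mcoeffB mcoeffZ mcoeff_torus // -mulrBl mulf_eq0 negb_or.
    move=> /andP [nz_c ->] /=; apply: contra nz_c => /eqP ->; by rewrite subrr.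
  apply: (IHs (act (torus t) f - weight_char mu t *: f) lt_d).
  - rewrite -ltnS; apply: leq_trans le_s; rewrite (perm_size (perm_to_rem m0f)) /= ltnS.
    apply: uniq_leq_size => [|m /supE /andP [mf ne]]; first exact: msupp_uniq.
    by rewrite mem_rem_uniq ?msupp_uniq // inE ne mf.
  - by apply: WB => //; apply: Wact.
  - by rewrite subr_eq0; apply/eqP.
  - by move=> m /supE /andP [/hf].
  - by move=> m /supE /andP [/lf].
exists mu, f; split=> //; split=> // [g Ug|t nz_t].
  by apply: boolp.contrapT => nfix; apply: Ufix; exists g.
by apply: boolp.contrapT => nfix; apply: Tfix; exists t.
Qed.

End Existence.

(** * Irreducibility of the generic minors *)

Lemma cofactor_eq (R : comNzRingType) n (A B : 'M[R]_n) i j :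
  (forall i' j', i' != i -> j' != j -> A i' j' = B i' j') ->
  cofactor A i j = cofactor B i j.
Proof.
move=> AB; rewrite /cofactor; congr (_ * \det _); apply/matrixP => k l.
by rewrite !mxE AB // eq_sym neq_lift.
Qed.

(** The minor is affine in the entry [(k, k)], with slope the complementary minor. *)
Lemma lminor_shift (R : comNzRingType) n (M : 'M[R]_n) (k : 'I_n) (x : R) :
  lminor k.+1 (M + x *: delta_mx k k) = lminor k.+1 M + x * lminor k M.
Proof.
have Dk : lminor k M = cofactor (trunc_mx k.+1 M) k k.
  rewrite /lminor (expand_det_row _ k) (bigD1 k) //= big1 ?addr0 => [|j ne_jk].
    rewrite [trunc_mx _ _ _ _]mxE ltnn eqxx mul1r; apply: cofactor_eq => i j ne_i ne_j.
    have ltS (l : 'I_n) : l != k -> (l < k.+1)%N = (l < k)%N.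
      by move=> ne_l; rewrite ltnS leq_eqVlt val_eqE (negPf ne_l).
    by rewrite ![trunc_mx _ _ _ _]mxE !ltS.
  by rewrite [trunc_mx _ _ _ _]mxE ltnn eq_sym (negPf ne_jk) mul0r.
rewrite {}Dk /lminor !(expand_det_row _ k).
have cofE j : cofactor (trunc_mx k.+1 (M + x *: delta_mx k k)) k j =
    cofactor (trunc_mx k.+1 M) k j.
  apply: cofactor_eq => i' j' ne_i _; rewrite !mxE (negPf ne_i) mulr0 addr0 //.
rewrite (bigD1 k) //= [in RHS](bigD1 k) //= cofE addrAC -mulrDl.
congr (_ * _ + _); first by rewrite !mxE ltnSn !eqxx mulr1.
apply: eq_bigr => j ne_jk; rewrite cofE; congr (_ * _).
by rewrite !mxE (negPf ne_jk) andbF mulr0 addr0.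
Qed.

Section Shift.
Variables (R : comNzRingType) (N : nat) (d : 'I_N -> R).

(** Taylor expansion [f(X + d T)] as a polynomial in the new variable [T]. *)
Definition shift : {mpoly R[N]} -> {poly {mpoly R[N]}} :=
  mmap (polyC \o @mpolyC N R) (fun v => ('X_v)%:P + (d v)%:MP%:P * 'X).

HB.instance Definition _ := GRing.RMorphism.copy shift shift.

Lemma shift_at0 f : (shift f)`_0 = f.
Proof.
move: f; apply: mpoly_gen_ind => [c|v|p q IHp IHq|p q IHp IHq].
- by rewrite /shift mmapC /= coefC.
- by rewrite /shift mmapX mmap1U coefD coefC coefMX addr0.
- by rewrite rmorphD coefD; congr (_ + _).
- have -> : shift (p * q) = shift p * shift q by exact: rmorphM.
  by rewrite coef0M; congr (_ * _).
Qed.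

Lemma shift_linear_form (c : 'I_N -> R) :
  shift (\sum_v c v *: 'X_v) = (\sum_v c v *: 'X_v)%:P + (\sum_v c v * d v)%:MP%:P * 'X.
Proof.
rewrite rmorph_sum (rmorph_sum (@mpolyC N R)) !(rmorph_sum (@polyC _)) mulr_suml -big_split /=.
apply: eq_bigr => v _; rewrite -mul_mpolyC rmorphM /= {1}/shift mmapC /=.
rewrite {1}/shift mmapX mmap1U mulrDr polyCM; congr (_ + _).
by rewrite mpolyCM polyCM mulrA.
Qed.
End Shift.

Section Irreducible.
Variables (F : numFieldType) (n : nat).
Local Notation S := (symAlg (tangent F n)).
Local Notation N := (\dim {:tangent F n}).

(** The shift of the diagonal entry [(i, i)] of the symmetric matrix. *)
Definition diag_shift (i : 'I_n) : S -> {poly S} :=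
  shift (fun v : 'I_N => ev (delta_mx i i) ('X_v : S)).

HB.instance Definition _ i := GRing.RMorphism.copy (diag_shift i) (diag_shift i).

Lemma diag_shift_sym_in i w : diag_shift i (sym_in w) =
  (sym_in w)%:P + (ev (delta_mx i i) (sym_in w))%:MP%:P * 'X.
Proof.
rewrite [LHS]shift_linear_form; congr (_ + _%:MP%:P * _).
by rewrite /sym_in rmorph_sum; apply: eq_bigr => v _; rewrite /= evZ.
Qed.

Lemma shift_gen i : map_mx (diag_shift i) (gen_mx F n) = map_mx polyC (gen_mx F n) + 'X *: delta_mx i i.
Proof.
apply/matrixP => k l; rewrite mxE [RHS]mxE [map_mx _ _ _ _]mxE.
have -> : ('X *: delta_mx i i : 'M[{poly S}]_n) k l =
    (ev (delta_mx i i) (gen_mx F n k l))%:MP%:P * 'X.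
  rewrite ev_gen sym_part_id ?trmx_delta // !mxE.
  by case: andP => _; rewrite ?mulr1 ?mul1r ?mulr0 ?mul0r.
by rewrite [gen_mx _ _ _ _]mxE diag_shift_sym_in.
Qed.

Lemma shift_gen_minor (k : 'I_n) :
  diag_shift k (gen_minor F n k.+1) = (gen_minor F n k.+1)%:P + 'X * (gen_minor F n k)%:P.
Proof.
by rewrite /gen_minor map_lminor shift_gen lminor_shift -!map_lminor.
Qed.

Lemma gen_minor_neq0 k : (k <= n)%N -> gen_minor F n k != 0.
Proof.
move=> le_kn; apply/eqP => D0; have := ev_gen_minor k (1%:M : 'M[F]_n).
rewrite D0 raddf0 sym_part_id ?trmx1 // lminor_unitri => [/esym/eqP|i j _].
  by rewrite oner_eq0.
by rewrite mxE.
Qed.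

Lemma ev_swap_gen_minor (k : 'I_n) m : (m <= n)%N ->
  (ev (swap_mx F k) (gen_minor F n m) == 0) = (m == k.+1).
Proof.
move=> le_mn; rewrite ev_gen_minor sym_part_id ?swap_mx_tr // lminor_swap_mx //.
case: (m == _); first by rewrite eqxx.
by case: leqP => _; rewrite ?oppr_eq0 oner_eq0.
Qed.

(** The product of the shifted factors has degree one in [T], so one shifted factor is
    constant in [T]; it then divides the coefficient of [T], which is the smaller minor. *)
Lemma gen_minor_factor (k : 'I_n) p q : gen_minor F n k.+1 = p * q ->
  (exists r, p * r = gen_minor F n k) \/ (exists r, q * r = gen_minor F n k).
Proof.
move=> Dpq; have sD := shift_gen_minor k; rewrite {1}Dpq rmorphM /= in sD.
have nzD := gen_minor_neq0 (ltnW (ltn_ord k)).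
have size2 : size (diag_shift k p * diag_shift k q) = 2.
  by rewrite sD addrC mulrC size_MXaddC polyC_eq0 (negPf nzD) size_polyC nzD.
have nz_sp : diag_shift k p != 0 by apply/eqP => E; move: size2; rewrite E mul0r size_poly0.
have nz_sq : diag_shift k q != 0 by apply/eqP => E; move: size2; rewrite E mulr0 size_poly0.
have fac p' q' : diag_shift k p' * diag_shift k q' =
      (gen_minor F n k.+1)%:P + 'X * (gen_minor F n k)%:P -> (size (diag_shift k p') <= 1)%N ->
    exists r, p' * r = gen_minor F n k.
  move=> E /size1_polyC Ep; exists (diag_shift k q')`_1.
  have p'E : p' = (diag_shift k p')`_0 by rewrite -[LHS](shift_at0 (fun v : 'I_N => ev (delta_mx k k) ('X_v : S))) {1}Ep coefC.
  rewrite {1}p'E -coefCM -Ep E coefD coefC /= add0r mulrC coefMX coefC eqxx //.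
have := size_mul nz_sp nz_sq; rewrite size2 => sizeD.
have [le_p|lt_p] := leqP (size (diag_shift k p)) 1; first by left; apply: (fac _ q).
right; apply: (fac _ p); first by rewrite mulrC.
rewrite -(leq_add2l (size (diag_shift k p))) addn1.
by move: sizeD; case: (_ + _)%N => //= m <-.
Qed.

(** By induction on the size.  A factor [p] of the minor of size [k + 2] that divides the
    irreducible minor of size [k + 1] is a unit or associated with it; the latter is excluded
    at [swap_mx k], where only the minor of size [k + 1] vanishes. *)
Lemma gen_minor_irreducible k : (k < n)%N -> irreducible_mpoly (gen_minor F n k.+1).
Proof.
have nonunit (i : 'I_n) : gen_minor F n i.+1 \isn't a GRing.unit.
  apply/negP => /(rmorph_unit (ev (swap_mx F i))).
  by rewrite unitfE ev_swap_gen_minor // eqxx.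
elim: k => [|k IH] lt_kn; (split; [exact: gen_minor_neq0 | exact: nonunit (Ordinal lt_kn) |]).
  move=> p q /(gen_minor_factor (k := Ordinal lt_kn)) /=; rewrite /gen_minor lminor0.
  case=> -[r pr1]; [left|right]; apply/unitrP; exists r; rewrite [r * _]mulrC; by split.
have [_ _ irrD] := IH (ltnW lt_kn).
have divD p q r : gen_minor F n k.+2 = p * q -> p * r = gen_minor F n k.+1 -> p \is a GRing.unit.
  move=> Dpq prD; have [//|unit_r] := irrD _ _ (esym prD).
  have E : gen_minor F n k.+2 = gen_minor F n k.+1 * (r^-1 * q).
    by rewrite -prD mulrA mulrK.
  pose i := Ordinal (ltnW lt_kn); have := ev_swap_gen_minor i lt_kn.
  have := ev_swap_gen_minor i (ltnW lt_kn); rewrite eqxx => /eqP Di0.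
  rewrite E (rmorphM (ev (swap_mx F i))) [X in X * _]Di0 mul0r eqxx => /esym/eqP.
  by move/eqP; rewrite eqn_leq ltnn.
move=> p q Dpq; have [[r]|[r]] := gen_minor_factor (k := Ordinal lt_kn) Dpq.
  by move/(divD _ _ _ Dpq); left.
by move=> qr; right; apply: (divD _ _ _ _ qr); rewrite Dpq mulrC.
Qed.

End Irreducible.

(** * Orthogonal projection onto a subspace *)

Section FiniteSpan.
Variables (F : fieldType) (N : nat).
Implicit Types W : {mpoly F[N]} -> Prop.

Lemma row_subspace_span (D : nat) (W : 'rV[F]_D -> Prop) :
  exists k (A : 'M[F]_(k, D)), (forall i, W (row i A)) /\ forall v, W v -> (v <= A)%MS.
Proof.
(* Rows outside the current row space are added until there are none; the number of steps
   is bounded by the corank. *)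
suff main j : forall k (A : 'M[F]_(k, D)), (forall i, W (row i A)) ->
    (D <= \rank A + j)%N ->
  exists k (A : 'M[F]_(k, D)), (forall i, W (row i A)) /\ forall v, W v -> (v <= A)%MS.
  by apply: (main D 0%N 0) => [[]//|]; rewrite leq_addl.
elim: j => [|j IH] k A WA le_D.
  exists k, A; split=> // v _; apply: submx_full.
  by rewrite /row_full eqn_leq rank_leq_col -[\rank A]addn0.
have [[v [Wv nAv]]|] := boolp.lem (exists v, W v /\ ~~ (v <= A)%MS); last first.
  move=> noW; exists k, A; split=> // v Wv; apply/negPn/negP => nAv.
  by apply: noW; exists v.
apply: (IH _ (col_mx A v)) => [i|].
  rewrite -(splitK i); case: split => i' /=; first by rewrite rowKu.
  by rewrite rowKd row_id.
apply: leq_trans le_D _; rewrite addnS -addSn leq_add2r; apply: rank_ltmx.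
rewrite ltmxE; apply/andP; split.
  by apply/(@submxP); exists (row_mx 1%:M 0); rewrite mul_row_col mul1mx mul0mx addr0.
by rewrite col_mx_sub negb_and nAv orbT.
Qed.

(** A set of polynomials of bounded degree has a finite subset with the same span. *)
Lemma mpoly_subspace_span b W : (forall f, W f -> (msize f <= b)%N) ->
  exists k (e : 'I_k -> {mpoly F[N]}), (forall i, W (e i)) /\
    forall f, W f -> exists c : 'rV[F]_k, f = \sum_i c 0 i *: e i.
Proof.
move=> Wb; pose D := #|{: 'X_{1..N < b}}|.
(* Polynomials of size at most [b] as rows of coefficients. *)
pose psi (v : 'rV[F]_D) : {mpoly F[N]} := \sum_i v 0 i *: 'X_[(enum_val i : 'X_{1..N < b})].
have [k [A [WA spanA]]] := @row_subspace_span D (fun v => W (psi v)).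
exists k, (fun i => psi (row i A)); split=> // f Wf.
have psif : psi (\row_i f@_(enum_val i : 'X_{1..N < b})) = f.
  rewrite [RHS](mpolywE (Wb f Wf)) /psi [RHS](reindex _ (onW_bij _ (enum_val_bij _))) /=.
  by apply: eq_bigr => i _; rewrite mxE.
have [|u uE] := @submxP _ _ _ _ _ _ (spanA (\row_i f@_(enum_val i : 'X_{1..N < b})) _).
  by rewrite psif.
exists u; rewrite -psif uE /psi.
under [RHS]eq_bigr => i _ do rewrite scaler_sumr.
rewrite [RHS]exchange_big /=; apply: eq_bigr => j _; rewrite mxE scaler_suml.
by apply: eq_bigr => i _; rewrite scalerA mxE.
Qed.

(** The coefficients [c] of the projection solve the linear system given by the Gram matrix
    [G] of the spanning family.  It is solvable as the kernel of [G] consists of relations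
    among the [e i], by nondegeneracy on [W]. *)
Lemma orth_projection (M : lmodType F) (B : M -> M -> F) (W : M -> Prop) k (e : 'I_k -> M) :
    (forall u a v w, B u (a *: v + w) = a * B u v + B u w) -> (forall u v, B u v = B v u) ->
    subspace W -> (forall i, W (e i)) ->
    (forall f, W f -> exists c : 'rV[F]_k, f = \sum_i c 0 i *: e i) ->
    (forall f, W f -> (forall w, W w -> B f w = 0) -> f = 0) ->
  forall v, exists2 s, W s & forall w, W w -> B (v - s) w = 0.
Proof.
move=> Blin Bsym [W0 Wlin] We span nondeg v.
have Br0 u : B u 0 = 0.
  have := Blin u 1 0 0; rewrite scaler0 addr0 mul1r => E.
  by apply: (addrI (B u 0)); rewrite -E addr0.
have BZ u a w : B u (a *: w) = a * B u w by rewrite -[a *: w]addr0 Blin Br0 addr0.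
have BD u w w' : B u (w + w') = B u w + B u w' by rewrite -{1}[w]scale1r Blin mul1r.
have Bsum u (c : 'I_k -> F) : B u (\sum_i c i *: e i) = \sum_i c i * B u (e i).
  rewrite (big_morph (B u) (BD u) (Br0 u)); apply: eq_bigr => i _; exact: BZ.
have Wsum (c : 'I_k -> F) : W (\sum_i c i *: e i).
  by apply: (big_ind W) => // [x y Wx Wy|i _]; [rewrite -[x]scale1r | rewrite -[_ *: _]addr0]; apply: Wlin.
pose G := \matrix_(i, j) B (e i) (e j); pose w := \row_j B v (e j).
have /submxP [c wE] : (w <= G)%MS.
  rewrite submxE; apply/eqP/rowP => j; rewrite [RHS]mxE.
  pose y := \sum_i cokermx G i j *: e i.
  have y0 : y = 0.
    apply: nondeg => [|f /span [d ->]]; first exact: Wsum.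
    rewrite Bsum big1 // => i _; rewrite Bsym Bsum; apply/eqP; rewrite mulf_eq0; apply/orP; right.
    have := congr1 (fun M : 'M_k => M i j) (mulmx_coker G); rewrite mxE [RHS]mxE => E.
    rewrite -[X in _ == X]E; apply/eqP/eq_bigr => l _.
    by rewrite [G _ _]mxE mulrC.
  have := Bsum v (fun i => cokermx G i j); rewrite -/y y0 Br0 => E; rewrite [RHS]E mxE.
  by apply: eq_bigr => i _; rewrite [w _ _]mxE mulrC.
exists (\sum_i c 0 i *: e i) => [|f /span [d ->]]; first exact: Wsum.
rewrite Bsum big1 // => i _; apply/eqP; rewrite mulf_eq0; apply/orP; right.
have /rowP/(_ i) := wE; rewrite !mxE => Bve.
rewrite Bsym BD -scaleN1r BZ mulN1r Bsum Bsym Bve -sumrB big1 // => j _.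
by rewrite mxE [B (e j) _]Bsym subrr.
Qed.

End FiniteSpan.

(** * Submodules and their orthogonals *)

Section Modules.
Variables (F : numClosedFieldType) (n : nat).
Local Notation S := (symAlg (tangent F n)).
Local Notation act := (@sym_act F n).
Local Notation hmon := (@hwv_mon F n).
Implicit Types (f h w : S) (g : 'M[F]_(n + n)) (t : 'rV[F]_n) (W : S -> Prop).
Implicit Types (e : 'I_n -> nat) (mu : weight n).

Definition fischer_form f f' : F := fischer (iota_mx f) (iota_mx f').

Lemma fischer_formC f f' : fischer_form f f' = fischer_form f' f.
Proof. exact: fischerC. Qed.

Lemma fischer_formP f c f1 f2 : fischer_form f (c *: f1 + f2) = c * fischer_form f f1 + fischer_form f f2.
Proof. by rewrite /fischer_form !linearP. Qed.

Lemma fischer_formD f f1 f2 : fischer_form f (f1 + f2) = fischer_form f f1 + fischer_form f f2.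
Proof. by rewrite /fischer_form !linearD. Qed.

Lemma fischer_form0 f : fischer_form f 0 = 0.
Proof. by rewrite /fischer_form !linear0. Qed.

Lemma sym_actD g f f' : act g (f + f') = act g f + act g f'.
Proof. by rewrite !sym_actE linearD. Qed.

Lemma sym_act0 g : act g 0 = 0.
Proof. by rewrite !sym_actE linear0. Qed.

Lemma sym_actZ g c f : act g (c *: f) = c *: act g f.
Proof. by rewrite !sym_actE linearZ. Qed.

Lemma sym_act_homog g r f : Sym r f -> Sym r (act g f).
Proof. by rewrite /Sym sym_actE; apply: dhomog_msubst. Qed.

Lemma ev_inj f f' : (forall Z, ev Z f = ev Z f') -> f = f'.
Proof.
move=> E; apply/eqP; rewrite -subr_eq0; apply/eqP; apply: ev_eq0 => Z _.
have -> : ev Z (f - f') = ev Z f - ev Z f' by exact: raddfB.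
by rewrite E subrr.
Qed.

Lemma Levi_ul g : Levi g -> Pn g /\ ulsubmx g \in unitmx.
Proof. by case=> Pg _; have [_ _ _] := Pn_blocks Pg. Qed.

(** The unipotent radical of [Pn] acts trivially. *)
Lemma sym_act_Pn g f : Pn g -> act g f = act (levi_mx (ulsubmx g)) f.
Proof.
move=> Pg; have [_ _ _ aU] := Pn_blocks Pg; have [Pl _] := levi_mxP aU.
by apply: ev_inj => Z; rewrite (ev_act _ _ Pg) (ev_act _ _ Pl) ul_levi_mx.
Qed.

Lemma sym_act_comp g g' f : Levi g -> Levi g' ->
  act g (act g' f) = act (levi_mx (ulsubmx g *m ulsubmx g')) f.
Proof.
move=> /Levi_ul [Pg aU] /Levi_ul [Pg' aU']; apply: ev_inj => Z.
have [Pl _] : Levi (levi_mx (ulsubmx g *m ulsubmx g')).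
  by apply: levi_mxP; rewrite unitmx_mul aU.
by rewrite (ev_act _ _ Pg) (ev_act _ _ Pg') (ev_act _ _ Pl) ul_levi_mx trmx_mul !mulmxA.
Qed.

(** The adjoint of [g] for the Fischer pairing. *)
Definition levi_tr g := levi_mx (ulsubmx g)^T.

Lemma levi_trP g : Levi g -> Levi (levi_tr g).
Proof. by move=> /Levi_ul [_ aU]; apply: levi_mxP; rewrite unitmx_tr. Qed.

Lemma fischer_form_act g f f' : Levi g -> fischer_form (act g f) f' = fischer_form f (act (levi_tr g) f').
Proof.
move=> Lg; have [Pg _] := Levi_ul Lg; have [Pt _] := Levi_ul (levi_trP Lg).
by rewrite /fischer_form (iota_act _ Pg) (iota_act _ Pt) ul_levi_mx fischer_msubst conj_mx_tr.
Qed.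

Lemma sym_act1 f : act (levi_mx 1%:M) f = f.
Proof.
have [P1 _] := levi_mxP (unitmx1 F n).
by apply: ev_inj => Z; rewrite ev_act // ul_levi_mx trmx1 mul1mx mulmx1.
Qed.

Local Notation Lsub := (submodule (@Levi F n) act).

Lemma Levi_Pn_submodule W : Lsub W -> submodule (@Pn F n) act W.
Proof.
case=> [Wsub Wact]; split=> // g f Pg Wf; rewrite sym_act_Pn //; apply: Wact => //.
by apply: levi_mxP; have [_ _ _] := Pn_blocks Pg.
Qed.

Lemma Pn_Levi_submodule W : submodule (@Pn F n) act W -> Lsub W.
Proof. by case=> [Wsub Wact]; split=> // g f [Pg _]; apply: Wact. Qed.

Lemma submoduleZ W c f : Lsub W -> W f -> W (c *: f).
Proof. by case=> [[W0 Wlin] _] Wf; rewrite -[_ *: f]addr0; apply: Wlin. Qed.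

Lemma submoduleB W f f' : Lsub W -> W f -> W f' -> W (f - f').
Proof. by case=> [[W0 Wlin] _] Wf Wf'; rewrite addrC -scaleN1r; apply: Wlin. Qed.

Lemma submodule_unscale W c f : Lsub W -> c != 0 -> W (c *: f) -> W f.
Proof.
by move=> Wsub nz_c /(submoduleZ c^-1 Wsub); rewrite scalerA mulVf // scale1r.
Qed.

Lemma Sym_submodule r : Lsub (@Sym F _ r).
Proof.
split; last by move=> g f _; apply: sym_act_homog.
by split=> [|a u v Su Sv]; rewrite /Sym ?dhomog0 // rpredD ?rpredZ.
Qed.

Definition perp W f := forall w, W w -> fischer_form f w = 0.

Lemma perp_submodule W : Lsub W -> Lsub (perp W).
Proof.
move=> Wsub; split; last first.
  by move=> g f Lg pf w Ww; rewrite fischer_form_act //; apply: pf; apply: (proj2 Wsub) => //; apply: levi_trP.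
split=> [w _|a u v pu pv w Ww]; first by rewrite fischer_formC fischer_form0.
by rewrite fischer_formC fischer_formP !(fischer_formC w) pu // pv // mulr0 addr0.
Qed.

Lemma cap_submodule W1 W2 : Lsub W1 -> Lsub W2 -> Lsub (fun f => W1 f /\ W2 f).
Proof.
move=> [[W10 W1lin] W1act] [[W20 W2lin] W2act]; split.
  by split=> // a u v [u1 u2] [v1 v2]; split; [apply: W1lin | apply: W2lin].
by move=> g f Lg [f1 f2]; split; [apply: W1act | apply: W2act].
Qed.

Definition generated h f := forall W, Lsub W -> W h -> W f.

Lemma generated_submodule h : Lsub (generated h).
Proof.
split; last by move=> g f Lg gf W Wsub Wh; apply: (proj2 Wsub) => //; apply: gf.
split=> [W [[W0 _] _] //|a u v gu gv W Wsub Wh].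
by case: (Wsub) => [[_ Wlin] _]; apply: Wlin; [apply: gu | apply: gv].
Qed.

Lemma generated_self h : generated h h.
Proof. by []. Qed.

Lemma hwv_mon_real e : iota_mx (hmon e) \is a mpolyOver (n * n) (@Num.Def.real_num_pred F).
Proof.
have real_gen k l : iota_mx (gen_mx F n k l) \is a mpolyOver (n * n) (@Num.Def.real_num_pred F).
  rewrite [gen_mx _ _ _ _]mxE iota_sym_in mx_tanK.
  apply: rpred_sum => v _; apply: mpolyOverZ; last exact: mpolyOverX.
  case/mxvec_indexP: v => p q; rewrite mxvecE sym_partE !mxE.
  by rewrite rpredM ?rpredV ?rpredD ?rpred_nat ?rpred1.
rewrite /hwv_mon (rmorph_prod (@iota_mx F n)); apply: rpred_prod => k _; rewrite rmorphXn; apply: rpredX.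
rewrite /= /gen_minor map_lminor /lminor /determinant; apply: rpred_sum => s _.
apply: rpredM; first by apply: rpred_sign.
apply: rpred_prod => i _; rewrite mxE; case: ifP => _; last exact: rpred_nat.
by rewrite [map_mx _ _ _ _]mxE; apply: real_gen.
Qed.

Lemma fischer_form_hmon_neq0 e : fischer_form (hmon e) (hmon e) != 0.
Proof.
apply/eqP => /(fischer_real (hwv_mon_real e)) h0; have := hwv_mon_neq0 F e.
by rewrite (_ : hmon e = 0) ?eqxx //; apply: iota_mx_inj; rewrite h0 linear0.
Qed.

(** Pairing with the simple coroots recovers the exponents. *)
Lemma wt_mon_inj e e' : wt_mon e = wt_mon e' -> e =1 e'.
Proof.
have pair e0 (l : 'I_n) : \sum_(j < n) wt_mon e0 0 j * simple_coroot l 0 j = (e0 l)%:R *+ 2.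
  transitivity (\sum_(k < n) \sum_(j < n) (fund_weight k 0 j * simple_coroot l 0 j) *+ 2 *+ e0 k).
    rewrite exchange_big; apply: eq_bigr => j _; rewrite /wt_mon summxE mulr_suml.
    by apply: eq_bigr => k _; rewrite !mulmxnE !mulrnAl.
  under eq_bigr => k _ do rewrite !sumrMnl fund_weight_coroot.
  rewrite (bigD1 l) //= big1 ?addr0 => [|k ne_kl]; first by rewrite eqxx mulrnAC.
  by rewrite (negPf ne_kl) !mul0rn.
move=> E l; have := pair e l; rewrite E pair => /eqP.
by rewrite -!mulrnA eqr_nat eqn_mul2r /= => /eqP.
Qed.

Lemma hmon_eq e e' : e =1 e' -> hmon e = hmon e'.
Proof. by move=> E; apply: eq_bigr => k _; rewrite E. Qed.

Lemma hmon_exists W f : Lsub W -> W f -> f != 0 -> exists e, W (hmon e).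
Proof.
move=> Wsub Wf nz_f; have [mu [h [Wh hh]]] := hwv_exists Wsub Wf nz_f.
have [e [_ [c nz_c hE]]] := hwv_classification hh.
by exists e; apply: (submodule_unscale Wsub nz_c); rewrite -hE.
Qed.

(** The intersection of [W] with its orthogonal would contain an isotropic product of minors. *)
Lemma submodule_nondegenerate W f : Lsub W -> W f -> perp W f -> f = 0.
Proof.
move=> Wsub Wf pf; apply/eqP/negPn/negP => nz_f.
have [e [We pe]] := hmon_exists (cap_submodule Wsub (perp_submodule Wsub)) (conj Wf pf) nz_f.
by have := fischer_form_hmon_neq0 e; rewrite pe ?eqxx.
Qed.

Lemma projection r W : Lsub W -> (forall f, W f -> Sym r f) ->
  forall f, exists2 s, W s & perp W (f - s).
Proof.
move=> Wsub WS f.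
have [|k [b [Wb span]]] := @mpoly_subspace_span F _ r.+1 W.
  move=> w /WS /dhomogP homw; rewrite msizeE; apply/bigmax_leqP_seq => m mw _.
  by rewrite homw.
apply: (orth_projection (B := fischer_form) fischer_formP fischer_formC (proj1 Wsub) Wb span) => w Ww pw.
exact: submodule_nondegenerate Wsub Ww pw.
Qed.

(** The two components of the vector along [W] and its orthogonal are again invariant under
    the unipotent group and of the same weight; by uniqueness the component in [W] is zero
    or proportional to the vector. *)
Lemma hwv_dichotomy r W e : Lsub W -> (forall f, W f -> Sym r f) ->
  W (hmon e) \/ perp W (hmon e).
Proof.
move=> Wsub WS; have [s Ws ps] := projection Wsub WS (hmon e).
have psub := perp_submodule Wsub.
have [_ Uh Th] := hwv_mon_hwv F e.
have stable g c : Levi g -> act g (hmon e) = c *: hmon e -> act g s = c *: s.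
  move=> Lg gh; apply/eqP; rewrite -subr_eq0; apply/eqP; apply: (submodule_nondegenerate Wsub).
    by apply: submoduleB => //; [apply: (proj2 Wsub) | apply: submoduleZ].
  have -> : act g s - c *: s = c *: (hmon e - s) - act g (hmon e - s).
    have -> : act g (hmon e - s) = c *: hmon e - act g s.
      by rewrite -gh -scaleN1r sym_actD sym_actZ scaleN1r.
    by rewrite scalerBr opprB [RHS]addrC addrA subrK.
  by apply: (submoduleB psub); [apply: (submoduleZ _ psub) | apply: (proj2 psub)].
have [s0|nz_s] := eqVneq s 0; first by right; move: ps; rewrite s0 subr0.
left; have hs : highest_weight_vector act (wt_mon e) s.
  split=> // [u Uu|t nz_t]; last first.
    by apply: stable; [have [] := torus_Levi nz_t | apply: Th].
  by rewrite -[RHS]scale1r; apply: stable; [case: Uu | rewrite scale1r; apply: Uh].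
have [e' [/wt_mon_inj Ee [c nz_c sE]]] := hwv_classification hs.
by rewrite (hmon_eq Ee); apply: (submodule_unscale Wsub nz_c); rewrite -sE.
Qed.

(** A submodule [W] of the generated module either contains the generator or is orthogonal to
    it; in the second case [W] is orthogonal to the whole generated module, hence to itself. *)
Lemma generated_irreducible e : irreducible_submodule (@Pn F n) act (generated (hmon e)).
Proof.
set r := (\sum_(k < n) k.+1 * e k)%N.
have genS f : generated (hmon e) f -> Sym r f.
  by apply; [apply: Sym_submodule | apply: hwv_mon_homog].
split; first exact/Levi_Pn_submodule/generated_submodule.
  by exists (hmon e); [apply: generated_self | apply: hwv_mon_neq0].
move=> W /Pn_Levi_submodule Wsub Wgen.
have WS f : W f -> Sym r f by move/Wgen/genS.
have [Wh|ph] := hwv_dichotomy e Wsub WS; [right=> f gf | left=> f Wf].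
  exact: gf.
exact: submodule_nondegenerate Wsub Wf (Wgen f Wf _ (perp_submodule Wsub) ph).
Qed.

End Modules.

(** * Orthogonality of the submodules generated by products of minors *)

Section AlongALine.
Variables (F : numFieldType) (n : nat).
Implicit Types (a b : 'M[F]_n) (p q : {mpoly F[n * n]}).

Definition line_mx a b : 'M[{poly F}]_n := map_mx polyC a + 'X *: map_mx polyC b.

Lemma line_mxE a b s : map_mx (horner_eval s) (line_mx a b) = a + s *: b.
Proof. by apply/matrixP => i j; rewrite !mxE /horner_eval !hornerE. Qed.

Lemma lminor_line a b k s : (lminor k (line_mx a b)).[s] = lminor k (a + s *: b).
Proof. by rewrite -line_mxE -map_lminor. Qed.

Lemma msubst_line a b p : exists P : {poly {mpoly F[n * n]}},
  forall s, msubst (conj_mx (a + s *: b)) p = P.[s%:MP].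
Proof.
move: p; apply: mpoly_gen_ind => [c|v|p q [P IHp] [Q IHq]|p q [P IHp] [Q IHq]].
- by exists (c%:MP)%:P => s; rewrite hornerC /msubst comp_mpolyC.
- exists (\sum_w map_poly (@mpolyC (n * n) F) (conj_mx (line_mx a b) w v) * ('X_w)%:P) => s.
  rewrite msubstX horner_sum; apply: eq_bigr => w _.
  rewrite hornerM hornerC horner_map mul_mpolyC /=; congr (_ *: _).
  case/mxvec_indexP: v => i j; case/mxvec_indexP: w => k l.
  by rewrite !conj_mxE hornerM -line_mxE !mxE.
- by exists (P + Q) => s; rewrite hornerD -IHp -IHq linearD.
- by exists (P * Q) => s; rewrite hornerM -IHp -IHq; exact: rmorphM.
Qed.

(** Along a line of matrices the Fischer pairing with a translate is polynomial in the
    parameter, which allows an argument by density. *)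
Lemma fischer_line a b p q : exists Q : {poly F},
  forall s, fischer (msubst (conj_mx (a + s *: b)) p) q = Q.[s].
Proof.
have [P PE] := msubst_line a b p; exists (\poly_(i < size P) fischer P`_i q) => s.
rewrite PE horner_coef horner_poly fischerC linear_sum; apply: eq_bigr => i _.
by rewrite -(rmorphXn (@mpolyC (n * n) F)) mulrC mul_mpolyC linearZ /= fischerC mulrC.
Qed.
End AlongALine.

Lemma exp2z_inj (F : numFieldType) : injective (exprz (2 : F)).
Proof.
have nz2 : (2 : F) != 0 by rewrite pnatr_eq0.
have one m : (2 : F) ^+ m = 1 -> m = 0%N.
  by move=> /eqP; rewrite -natrX pnatr_eq1 -(expn0 2) eqn_exp2l // => /eqP.
move=> a b E; apply/eqP; rewrite -subr_eq0.
have : (2 : F) ^ (a - b) = 1 by rewrite expfzDr // E -expfzDr // subrr.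
case: (a - b) => m; first by move=> /one ->.
by move=> /(congr1 GRing.inv); rewrite NegzE -exprnN invrK invr1 => /one.
Qed.

Section Orthogonality.
Variables (F : numClosedFieldType) (n : nat).
Local Notation S := (symAlg (tangent F n)).
Local Notation act := (@sym_act F n).
Local Notation hmon := (@hwv_mon F n).
Local Notation Lsub := (submodule (@Levi F n) act).
Implicit Types (f h w : S) (g : 'M[F]_(n + n)) (t : 'rV[F]_n) (W : S -> Prop).
Implicit Types (e : 'I_n -> nat) (mu : weight n).

Lemma msubst_hmon_unitri e u : upper_unitri u ->
  msubst (conj_mx u) (iota_mx (hmon e)) = iota_mx (hmon e).
Proof.
move=> uu; have [_ Uh _] := hwv_mon_hwv F e; have UL := levi_unipP uu.
have [Pu _] := Levi_unip_Pn UL.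
by rewrite -[in RHS](Uh _ UL) (iota_act _ Pu) ul_levi_mx.
Qed.

Lemma msubst_hmon_torus e t : (forall j, t 0 j != 0) ->
  msubst (conj_mx (diag_mx t)) (iota_mx (hmon e)) = weight_char (wt_mon e) t *: iota_mx (hmon e).
Proof.
move=> nz_t; have [_ _ Th] := hwv_mon_hwv F e.
have [[Pt _] tE] := torus_Levi nz_t.
have := congr1 (@iota_mx F n) (Th _ nz_t); rewrite (iota_act _ Pt) tE => ->.
exact: linearZ.
Qed.

(** A torus element is self-adjoint and acts on both vectors by different scalars. *)
Lemma fischer_form_hmon_orth e e' k : e k != e' k -> fischer_form (hmon e) (hmon e') = 0.
Proof.
move=> ne_k; have [j ne_j] : exists j, wt_mon e 0 j != wt_mon e' 0 j.
  apply/existsP; apply: contraR ne_k; rewrite negb_exists => /forallP E.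
  apply/eqP; apply: wt_mon_inj; apply/rowP => j; apply/eqP; exact: negbNE (E j).
(* The weights differ at [j], so the eigenvalues are distinct powers of [2]. *)
pose t : 'rV[F]_n := \row_i (if i == j then 2 else 1).
have nz_t i : t 0 i != 0 by rewrite mxE; case: ifP; rewrite ?oner_neq0 ?pnatr_eq0.
have wE mu : weight_char mu t = 2 ^ mu 0 j.
  rewrite /weight_char (bigD1 j) //= big1 ?mulr1 => [|i ne_ij]; first by rewrite mxE eqxx.
  by rewrite mxE (negPf ne_ij) exp1rz.
have := fischer_msubst (conj_mx (diag_mx t)) (iota_mx (hmon e)) (iota_mx (hmon e')).
rewrite conj_mx_tr tr_diag_mx !msubst_hmon_torus // fischerC !linearZ /= fischerC.
move=> /eqP; rewrite -subr_eq0 -mulrBl mulf_eq0 !wE => /orP [|/eqP //].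
by rewrite subr_eq0 => /eqP /exp2z_inj /eqP; rewrite (negPf ne_j).
Qed.

(** If [a = l t u], then [<a h, h_1> = <t u h, l^T h_1>] is a multiple of [<h, h_1>], which is
    zero.  On the line [1 + s (a - 1)] this factorization exists except at finitely many [s],
    so the pairing, polynomial in [s], vanishes at [s = 1]. *)
Lemma fischer_form_act_hmon e e' k g : e k != e' k -> Levi g -> fischer_form (act g (hmon e)) (hmon e') = 0.
Proof.
move=> ne_k Lg; have [Pg _] := Levi_ul Lg; rewrite /fischer_form (iota_act _ Pg).
move: (ulsubmx g) => a {g Lg Pg}; have orth := fischer_form_hmon_orth ne_k.
have [Q QE] := fischer_line 1%:M (a - 1%:M) (iota_mx (hmon e)) (iota_mx (hmon e')).
have aE : a = 1%:M + 1 *: (a - 1%:M) by rewrite scale1r addrC subrK.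
rewrite aE QE; pose D := \prod_(k < n) lminor k.+1 (line_mx 1%:M (a - 1%:M)).
suff -> : Q = 0 by rewrite horner0.
have : Q * D = 0.
  apply: poly_vanish => s; rewrite hornerM -QE.
  have [->|nz_D] := eqVneq D.[s] 0; first exact: mulr0.
  have [|l [t [u [lu uu bE nz_t _]]]] := @LDU_decomposition F n (1%:M + s *: (a - 1%:M)).
    case=> [|m] lt_mn; first by rewrite lminor0 oner_neq0.
    move: nz_D; rewrite horner_prod => /prodf_neq0/(_ (Ordinal lt_mn) isT).
    by rewrite lminor_line.
  rewrite bE -!conj_mxM -!msubst_comp fischer_msubst conj_mx_tr msubst_hmon_unitri //.
  rewrite msubst_hmon_torus // msubst_hmon_unitri // fischerC linearZ /= fischerC.
  by rewrite [fischer _ _]orth mulr0 mul0r.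
move/eqP; rewrite mulf_eq0 => /orP [/eqP //|/eqP D0].
have : D.[0] = 0 by rewrite D0 horner0.
rewrite horner_prod big1 => [/eqP|i _]; first by rewrite oner_eq0.
by rewrite lminor_line scale0r addr0 lminor_unitri // => i' j' _; rewrite mxE.
Qed.

(** The vectors orthogonal to all translates of the first generator form a submodule that
    contains the second generator. *)
Lemma generated_perp e e' k : e k != e' k -> forall w, generated (hmon e) w -> perp (generated (hmon e')) w.
Proof.
move=> ne_k w gw; apply: (gw _ (perp_submodule (generated_submodule _))) => {w gw} w gw.
have Xsub : Lsub (fun w => forall g, Levi g -> fischer_form (act g (hmon e)) w = 0).
  split; first split=> [g _|c f f' of_ of' g Lg]; first exact: fischer_form0.
    by rewrite fischer_formP of_ // of' // mulr0 addr0.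
  move=> g f Lg of_ g' Lg'.
  have LT := levi_trP Lg.
  have -> : fischer_form (act g' (hmon e)) (act g f) = fischer_form (act (levi_tr g) (act g' (hmon e))) f.
    rewrite [RHS](fischer_form_act _ _ LT); have [Pg _] := Levi_ul Lg.
    by rewrite [act g f](sym_act_Pn _ Pg) {2}/levi_tr /levi_tr ul_levi_mx trmxK.
  rewrite sym_act_comp //; apply: of_; apply: levi_mxP.
  by rewrite unitmx_mul (proj2 (Levi_ul LT)) (proj2 (Levi_ul Lg')).
have := gw _ Xsub; rewrite -[hmon e in X in _ -> X]sym_act1; apply.
  by move=> g Lg; apply: fischer_form_act_hmon ne_k Lg.
by apply: levi_mxP; apply: unitmx1.
Qed.

End Orthogonality.

(** * Decomposition, multiplicities and fundamental weights *)

Section MainResult.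
Variables (F : numClosedFieldType) (n : nat).
Local Notation S := (symAlg (tangent F n)).
Local Notation act := (@sym_act F n).
Local Notation hmon := (@hwv_mon F n).
Local Notation Lsub := (submodule (@Levi F n) act).
Implicit Types (f h w : S) (g : 'M[F]_(n + n)) (t : 'rV[F]_n) (W : S -> Prop).

Lemma generated_is_E (e : 'I_n -> nat) : is_E act (wt_mon e) (generated (hmon e)).
Proof.
split; first exact: generated_irreducible.
by exists (hmon e); [apply: generated_self | apply: hwv_mon_hwv].
Qed.

(** If the sum of these submodules were not all of [Sym^r], the orthogonal component of some
    element would generate a product of minors of degree [r] orthogonal to the sum, although
    it lies in one of the summands.  Uniqueness follows from orthogonality. *)
Theorem Sym_direct_sum (r : nat) :
  is_direct_sum [pred i : {ffun 'I_n -> 'I_r.+1} | (\sum_(k < n) k.+1 * i k)%N == r]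
    (fun i => generated (hmon (fun k => i k : nat))) (@Sym F (tangent F n) r).
Proof.
set P := [pred i : {ffun 'I_n -> 'I_r.+1} | _].
pose W (i : {ffun 'I_n -> 'I_r.+1}) := generated (hmon (fun k => i k : nat)).
have WS i f : P i -> W i f -> Sym r f.
  move=> /eqP Pi; apply; first exact: Sym_submodule.
  by rewrite /Sym -[X in X.-homog]Pi; apply: hwv_mon_homog.
have Wsub i : Lsub (W i) by apply: generated_submodule.
split=> [i Pi f|f Sf]; first exact: WS.
pose sumW f' := exists2 c : {ffun 'I_n -> 'I_r.+1} -> S,
  forall i, P i -> W i (c i) & f' = \sum_(i | P i) c i.
have sumsub : Lsub sumW.
  split; first split=> [|a u v [cu Wu ->] [cv Wv ->]].
  - by exists (fun=> 0) => [i _|]; [have [[]] := Wsub i | rewrite big1].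
  - exists (fun i => a *: cu i + cv i) => [i Pi|]; last by rewrite scaler_sumr -big_split.
    by have [[_ lin] _] := Wsub i; apply: lin; [apply: Wu | apply: Wv].
  move=> g u Lg [cu Wu ->]; exists (fun i => act g (cu i)) => [i Pi|].
    by have [_ st] := Wsub i; apply: st => //; apply: Wu.
  exact: (big_morph _ (sym_actD g) (sym_act0 g)).
have sumS u : sumW u -> Sym r u.
  by case=> c Wc ->; apply: rpred_sum => i Pi; apply: WS (Wc i Pi).
have [s [c Wc sE] ps] := projection sumsub sumS f.
have fs : f = s.
  apply/eqP; rewrite -subr_eq0; apply/negPn/negP => nz.
  have Sfs : Sym r (f - s).
    by apply: (submoduleB (Sym_submodule F n r)) => //; apply: sumS; exists c.
  have [e [Se pe]] := hmon_exists (cap_submodule (Sym_submodule F n r) (perp_submodule sumsub))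
    (conj Sfs ps) nz.
  have degE : (\sum_(k < n) k.+1 * e k)%N = r.
    exact: dhomog_uniq (hwv_mon_neq0 F e) (hwv_mon_homog F e) Se.
  have le_r k : (e k < r.+1)%N.
    by rewrite ltnS -degE (bigD1 k) //= mulSn -addnA leq_addr.
  pose i := [ffun k => Ordinal (le_r k)].
  have iE : hmon e = hmon (fun k => i k : nat) by apply: hmon_eq => k; rewrite ffunE.
  have Pi : P i by apply/eqP; apply: etrans degE; apply: eq_bigr => k _; rewrite ffunE.
  have := fischer_form_hmon_neq0 F e; rewrite pe ?eqxx //.
  exists (fun j => if j == i then hmon e else 0) => [j Pj|].
    by case: eqP => [->|_]; [rewrite iE; apply: generated_self | have [[]] := Wsub j].
  by rewrite (bigD1 i) //= eqxx big1 ?addr0 // => j /andP [_ /negPf ->].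
exists [ffun i => if P i then c i else 0]; split.
  split=> [i Pi|i nPi|].
  - by rewrite ffunE Pi; apply: Wc.
  - by rewrite ffunE (negPf nPi).
  - by rewrite fs sE; apply: eq_bigr => i Pi; rewrite ffunE Pi.
move=> c' [Wc' c'0 fE]; apply/ffunP => i; rewrite ffunE; case: ifP => [Pi|nPi]; last first.
  by rewrite c'0 // nPi.
apply/eqP; rewrite -subr_eq0; apply/eqP.
apply: (submodule_nondegenerate (Wsub i)); first by apply: (submoduleB (Wsub i)); [apply: Wc | apply: Wc'].
(* The difference of two components lies in the sum of the other submodules. *)
have E : c i - c' i = \sum_(j | P j && (j != i)) (c' j - c j).
  have : \sum_(j | P j) c j = \sum_(j | P j) c' j by rewrite -sE -fs.
  rewrite sumrB (bigD1 i) //= [in RHS](bigD1 i) //= => E.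
  by apply/eqP; rewrite subr_eq addrAC -subr_eq opprK E [X in _ == X]addrC.
rewrite E => w Ww; rewrite fischer_formC (big_morph (fischer_form w) (fischer_formD w) (fischer_form0 w)) big1 // => j /andP [Pj ne_ji].
have [k ne_k] : exists k, (j k : nat) != i k.
  apply/existsP; apply: contraR ne_ji; rewrite negb_exists => /forallP jE.
  by apply/eqP/ffunP => k; apply/val_inj/eqP; exact: negbNE (jE k).
rewrite fischer_formC; apply: (generated_perp (e := fun k => j k : nat) (e' := fun k => i k : nat) ne_k) => //.
by apply: (submoduleB (Wsub j)); [apply: Wc' | apply: Wc].
Qed.

(** An isomorphism maps a highest weight vector to one of the same weight, that is, to a
    multiple of the same product of minors, so the two submodules intersect. *)
Theorem Sym_multiplicity_free : sym_multiplicity_free F n.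
Proof.
move=> W1 W2 [W1sub [f W1f nz_f] irr1] [W2sub _ irr2] [phi [lin W2phi inj _ equi]].
have [mu [h [Wh hh]]] := hwv_exists W1sub W1f nz_f.
have [[W10 _] _] := W1sub.
have phi0 : phi 0 = 0.
  have := lin 1 0 0 W10 W10; rewrite !scale1r addr0 => E.
  by apply: (addrI (phi 0)); rewrite -E addr0.
have phiZ c w : W1 w -> phi (c *: w) = c *: phi w.
  by move=> Ww; have := lin c w 0 Ww W10; rewrite phi0 !addr0.
have [nz_h Uh Th] := hh.
have hphi : highest_weight_vector act mu (phi h).
  split=> [|u Uu|t nz_t].
  - by apply: contra nz_h => /eqP /(inj _ Wh) ->.
  - by rewrite -equi ?Uh //; case: Uu.
  - by rewrite -equi ?Th ?phiZ //; have [] := torus_Levi nz_t.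
have [e [muE [c nz_c hE]]] := hwv_classification hh.
have [e' [muE' [c' nz_c' hE']]] := hwv_classification hphi.
have ee' : e =1 e' by apply: wt_mon_inj; rewrite -muE.
have W1e : W1 (hmon e) by apply: (submodule_unscale W1sub nz_c); rewrite -hE.
have W2e : W2 (hmon e).
  by rewrite (hmon_eq F ee'); apply: (submodule_unscale W2sub nz_c'); rewrite -hE'; apply: W2phi.
have capsub := cap_submodule W1sub W2sub.
have nz_e := hwv_mon_neq0 F e.
move=> w; split=> Ww.
  have [|cap0|capW] := irr1 _ capsub; first by move=> v [].
    by case/eqP: nz_e; apply: cap0.
  by have [] := capW w Ww.
have [|cap0|capW] := irr2 _ capsub; first by move=> v [].
  by case/eqP: nz_e; apply: cap0.
by have [] := capW w Ww.
Qed.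

Definition delta_exp (k : 'I_n) (l : 'I_n) : nat := (l == k).

Lemma hmon_delta k : hmon (delta_exp k) = gen_minor F n k.+1.
Proof.
rewrite /hwv_mon (bigD1 k) //= big1 => [|l ne_lk]; last by rewrite /delta_exp (negPf ne_lk) expr0.
by rewrite /delta_exp eqxx expr1 mulr1.
Qed.

Lemma wt_delta k : wt_mon (delta_exp k) = fund_weight k *+ 2.
Proof.
rewrite /wt_mon (bigD1 k) //= big1 => [|l ne_lk]; last by rewrite /delta_exp (negPf ne_lk).
by rewrite /delta_exp eqxx addr0.
Qed.

Lemma irreducible_scale c (p : S) : c != 0 -> irreducible_mpoly p -> irreducible_mpoly (c *: p).
Proof.
move=> nz_c [nz_p nu_p irr_p].
have uc : (c%:MP : S) \is a GRing.unit by apply: rmorph_unit; rewrite unitfE.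
have cpE : c *: p = c%:MP * p by rewrite mul_mpolyC.
split; rewrite ?cpE.
- by rewrite mulf_neq0 //; apply: contraTneq uc => ->; rewrite unitr0.
- by rewrite unitrMr.
- move=> a b /(canRL (mulKr uc)); rewrite mulrA => /irr_p [|]; last by right.
  by rewrite unitrMr ?unitrV //; left.
Qed.

(** An irreducible product of minors has a single factor, with exponent one. *)
Theorem fundamental_weights (mu : weight n) (d : nat) :
  fundamental_highest_weight F mu d <-> exists k : 'I_n, mu = fund_weight k *+ 2 /\ d = k.+1.
Proof.
split=> [[[h hh] fund]|[k [-> ->]]]; last first.
  split; first by exists (gen_minor F n k.+1); rewrite -hmon_delta -wt_delta; apply: hwv_mon_hwv.
  move=> h hh; have [e [muE [c nz_c ->]]] := hwv_classification hh.
  have ek : delta_exp k =1 e by apply: wt_mon_inj; rewrite wt_delta.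
  rewrite -(hmon_eq F ek) hmon_delta; split.
    by apply: irreducible_scale => //; apply: gen_minor_irreducible.
  by rewrite /Sym rpredZ // gen_minor_homog.
have [[nz_h nu_h irr_h] homh] := fund h hh.
have [e [muE [c nz_c hE]]] := hwv_classification hh.
have nuD (k : 'I_n) : gen_minor F n k.+1 \isn't a GRing.unit.
  by have [] := gen_minor_irreducible F (ltn_ord k).
have uc : (c%:MP : S) \is a GRing.unit by apply: rmorph_unit; rewrite unitfE.
have hE' : h = c%:MP * hmon e by rewrite hE mul_mpolyC.
have [k nz_ek] : exists k, e k != 0%N.
  apply/existsP; apply: contraR nu_h; rewrite negb_exists => /forallP e0.
  rewrite hE' /hwv_mon big1 ?mulr1 // => k _; have /negPn/eqP -> := e0 k; exact: expr0.
have prodE : hmon e = gen_minor F n k.+1 *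
    (gen_minor F n k.+1 ^+ (e k).-1 * \prod_(l < n | l != k) gen_minor F n l.+1 ^+ e l).
  by rewrite /hwv_mon (bigD1 k) //= [RHS]mulrA -exprS prednK // lt0n.
pose rest : S := c%:MP * (gen_minor F n k.+1 ^+ (e k).-1 * \prod_(l < n | l != k) gen_minor F n l.+1 ^+ e l).
have hfac : h = gen_minor F n k.+1 * rest.
  by rewrite hE' prodE /rest; exact: mulrCA.
have urest : rest \is a GRing.unit.
  by have [u|//] := irr_h _ _ hfac; have := nuD k; rewrite u.
have eE : e =1 delta_exp k.
  move=> l; rewrite /delta_exp; move: urest; rewrite /rest !unitrM => /and3P [_ uk ul].
  have [->|ne_lk] := eqVneq l k.
    move: uk nz_ek; case: (e k) => [|[|m]] //= ; rewrite unitrX_pos // => uk.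
    by have := nuD k; rewrite uk.
  move: ul; rewrite (bigD1 l) //= unitrM => /andP [ul _].
  case: (e l) ul => [//|m]; rewrite unitrX_pos // => ul; by have := nuD l; rewrite ul.
exists k; split.
  rewrite muE -wt_delta /wt_mon; apply: eq_bigr => l _; by rewrite eE.
have hh' : h = c *: gen_minor F n k.+1 by rewrite hE (hmon_eq F eE) hmon_delta.
apply: (dhomog_uniq nz_h homh); rewrite hh'; apply: dhomogZ.
by apply: gen_minor_homog.
Qed.

End MainResult.

Theorem mainTheorem10 (R : realType) (n : nat) (hn : (2 <= n)%N) :
  (forall r : nat,
     exists W : {ffun 'I_n -> 'I_r.+1} -> symAlg (tangent R[i] n) -> Prop,
       (forall i : {ffun 'I_n -> 'I_r.+1},
          (\sum_(k < n) k.+1 * i k)%N = r ->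
          is_E (@sym_act R[i] n) (\sum_(k < n) (fund_weight k *+ 2) *+ i k) (W i))
       /\ is_direct_sum
            [pred i : {ffun 'I_n -> 'I_r.+1} | (\sum_(k < n) k.+1 * i k)%N == r]
            W (@Sym R[i] (tangent R[i] n) r))
  /\ sym_multiplicity_free R[i] n
  /\ (forall (mu : weight n) (d : nat),
        fundamental_highest_weight R[i] mu d <->
        exists k : 'I_n, mu = fund_weight k *+ 2 /\ d = k.+1).
Proof.
split; last by split; [apply: Sym_multiplicity_free | apply: fundamental_weights].
move=> r; exists (fun i : {ffun 'I_n -> 'I_r.+1} => generated (hwv_mon R[i] (fun k => i k : nat))).
by split=> [i _|]; [apply: generated_is_E | apply: Sym_direct_sum].
Qed.
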